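(* Let $R$ be a commutative ring and let $(A,d_A,\mu_A)$ be a differential graded associative algebra over $R$, with $d_A$ of degree $+1$ and $\mu_A$ of degree $0$. Let $TA=\bigoplus_{n\ge 0}A^{\otimes n}$ carry the shifted grading, the shuffle product $\bullet$, and the coderivation lifts $d$ of $d_A$ and $\Delta$ of $\mu_A$ described in the context. Then $(TA,d,\Delta,\bullet)$ is a dBV algebra. The construction is functorial: if $f:A\to B$ is a morphism of differential graded associative algebras, then the induced map $\bigoplus_{n\ge0} f^{\otimes n}:TA\to TB$ is a morphism of dBV algebras.
   Context: All tensor products are over $R$, and $A^{\otimes 0}=R$. A differential graded associative algebra $(A,d_A,\mu_A)$ is a graded $R$-module $A$ with a differential $d_A$ of degree $+1$, $d_A^2=0$, and an associative product $\mu_A:A\otimes A\to A$ of degree $0$ for which $d_A$ is a graded derivation; no commutativity is assumed. Morphisms are degree $0$ $R$-linear maps commuting with differentials and products. Grading on $TA$: for homogeneous $a_i\in A$ the monomial $a_1\otimes\cdots\otimes a_n\in A^{\otimes n}$ has degree $|a_1|+\cdots+|a_n|+n$. Shuffle product: $\bullet:TA\otimes TA\to TA$ is the $R$-linear map determined by $$(a_1\otimes\cdots\otimes a_n)\bullet(a_{n+1}\otimes\cdots\otimes a_{n+m})=\sum_{\sigma\in S(n,m)}(-1)^{\kappa}\,a_{\sigma^{-1}(1)}\otimes\cdots\otimes a_{\sigma^{-1}(n+m)},$$ where $S(n,m)$ is the set of permutations $\sigma\in\Sigma_{n+m}$ with $\sigma(1)<\dots<\sigma(n)$ and $\sigma(n+1)<\dots<\sigma(n+m)$,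 and $\kappa$ is the Koszul sign exponent: it is the sum of $(|a_i|+1)(|a_j|+1)$ over all pairs $i<j$ with $\sigma(i)>\sigma(j)$. Operators $d$ (degree $+1$) and $\Delta$ (degree $-1$) on $TA$, the lifts of $d_A$ and $\mu_A$ to coderivations of the tensor (deconcatenation) coproduct: $$d(a_1\otimes\cdots\otimes a_n)=\sum_{i=1}^n(-1)^{|a_1|+\dots+|a_{i-1}|+i-1}\,a_1\otimes\cdots\otimes d_A(a_i)\otimes\cdots\otimes a_n,$$ $$\Delta(a_1\otimes\cdots\otimes a_n)=\sum_{i=1}^{n-1}(-1)^{|a_1|+\dots+|a_i|+i-1}\,a_1\otimes\cdots\otimes\mu_A(a_i,a_{i+1})\otimes\cdots\otimes a_n,$$ with $d=0$ on $A^{\otimes 0}$ and $\Delta=0$ on $A^{\otimes 0}\oplus A^{\otimes 1}$. A dBV algebra $(X,d,\Delta,\bullet)$ is a differential graded commutative associative algebra $(X,d,\bullet)$ with $d$ of degree $+1$ (so $d^2=0$, $d$ is a graded derivation of $\bullet$, and $\bullet$ is associative and graded commutative), together with a differential $\Delta$ of degree $-1$ (so $\Delta^2=0$) such that $d\Delta+\Delta d=0$, and such that the bracket $$\{x,y\}=(-1)^{|x|}\Delta(x\bullet y)-(-1)^{|x|}\Delta(x)\bullet y-x\bullet\Delta(y)$$ satisfies, for homogeneous $x,y,z$, $$\{x,y\}=-(-1)^{(|x|+1)(|y|+1)}\{y,x\},\qquad \{x\bullet y,z\}=x\bullet\{y,z\}+(-1)^{|y|(|z|+1)}\{x,z\}\bullet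 y.$$ A morphism of dBV algebras is a map preserving $d$, $\Delta$ and $\bullet$. *)

(* Defs.v *)
From HB Require Import structures.
From mathcomp Require Import all_boot all_order all_algebra perm.
From mathcomp Require Import boolp.

Set Implicit Arguments.
Unset Strict Implicit.
Unset Printing Implicit Defensive.

Import GRing.Theory.
Local Open Scope ring_scope.
Local Open Scope quotient_scope.

(* Graded modules are internally graded: a module X together with the family
   hom of its homogeneous parts, indexed by int.  "x has degree p" is
   "hom p x", so that 0 has every degree. *)

Section Structures.
Variables (R : comPzRingType) (X : lmodType R).

Definition sgn (p : int) : R := (-1) ^+ `|p|%N.

(* X is the internal direct sum of its submodules hom p. *)
Record is_grading (hom : int -> X -> Prop) : Prop := IsGrading {
  grading0 : forall p, hom p 0;
  gradingP : forall p (k : R) x y, hom p x -> hom p y -> hom p (k *: x + y);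
  grading_sum : forall x, exists (s : seq int) (c : int -> X),
    [/\ uniq s, forall p, hom p (c p) & x = \sum_(p <- s) c p];
  grading_free : forall (s : seq int) (c : int -> X),
    uniq s -> (forall p, hom p (c p)) -> \sum_(p <- s) c p = 0 ->
    forall p, p \in s -> c p = 0 }.

Record is_dga (hom : int -> X -> Prop) (d : X -> X) (mu : X -> X -> X) :
    Prop := IsDga {
  dga_grading : is_grading hom;
  dga_d_linear : linear d;
  dga_d_deg : forall p x, hom p x -> hom (p + 1) (d x);
  dga_dd : forall x, d (d x) = 0;
  dga_mu_linearl : forall y, linear (mu^~ y);
  dga_mu_linearr : forall x, linear (mu x);
  dga_mu_deg : forall p q x y, hom p x -> hom q y -> hom (p + q) (mu x y);
  dga_muA : associative mu;
  dga_leibniz : forall p x y, hom p x ->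
    d (mu x y) = mu (d x) y + sgn p *: mu x (d y) }.

(* The bracket {x, y}, for x of degree p. *)
Definition bracket (Delta : X -> X) (mu : X -> X -> X) (p : int) (x y : X) :=
  sgn p *: Delta (mu x y) - sgn p *: mu (Delta x) y - mu x (Delta y).

Record is_dBV (hom : int -> X -> Prop) (d Delta : X -> X) (mu : X -> X -> X) :
    Prop := IsDBV {
  dBV_dga : is_dga hom d mu;
  dBV_muC : forall p q x y, hom p x -> hom q y ->
    mu x y = sgn (p * q) *: mu y x;
  dBV_Delta_linear : linear Delta;
  dBV_Delta_deg : forall p x, hom p x -> hom (p - 1) (Delta x);
  dBV_DeltaDelta : forall x, Delta (Delta x) = 0;
  dBV_dDelta : forall x, d (Delta x) + Delta (d x) = 0;
  dBV_bracketC : forall p q x y, hom p x -> hom q y ->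
    bracket Delta mu p x y =
      - (sgn ((p + 1) * (q + 1)) *: bracket Delta mu q y x);
  dBV_bracket_leibniz : forall p q r x y z, hom p x -> hom q y -> hom r z ->
    bracket Delta mu (p + q) (mu x y) z =
      mu x (bracket Delta mu q y z)
      + sgn (q * (r + 1)) *: mu (bracket Delta mu p x z) y }.

End Structures.

Record dgAlgebra (R : comPzRingType) := DgAlgebra {
  dga_car :> lmodType R;
  dga_hom : int -> dga_car -> Prop;
  dga_d : dga_car -> dga_car;
  dga_mu : dga_car -> dga_car -> dga_car;
  dga_axioms : is_dga dga_hom dga_d dga_mu }.

Record is_dga_morphism (R : comPzRingType) (A B : dgAlgebra R) (f : A -> B) :
    Prop := IsDgaMorphism {
  dga_mor_linear : linear f;
  dga_mor_deg : forall p x, dga_hom p x -> dga_hom p (f x);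
  dga_mor_d : forall x, f (dga_d x) = dga_d (f x);
  dga_mor_mu : forall x y, f (dga_mu x y) = dga_mu (f x) (f y) }.

Record is_dBV_morphism (R : comPzRingType) (X Y : lmodType R)
    (homX : int -> X -> Prop) (dX DeltaX : X -> X) (muX : X -> X -> X)
    (homY : int -> Y -> Prop) (dY DeltaY : Y -> Y) (muY : Y -> Y -> Y)
    (f : X -> Y) : Prop := IsDBVMorphism {
  dBV_mor_linear : linear f;
  dBV_mor_deg : forall p x, homX p x -> homY p (f x);
  dBV_mor_d : forall x, f (dX x) = dY (f x);
  dBV_mor_Delta : forall x, f (DeltaX x) = DeltaY (f x);
  dBV_mor_mu : forall x y, f (muX x y) = muY (f x) (f y) }.

(* The tensor module TA is the R-module generated by the words in A (the word
   [:: a1; ..; an] standing for the tensor a1 (x) .. (x) an), subject to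
   linearity in every letter.  A formal combination of words is a list of
   pairs (coefficient, word); addition is concatenation.  The relations
   preserve the length of words, and words of length n generate the n-th
   tensor power of A; the empty word generates a copy of R. *)

Section Tensor.
Variables (R : comPzRingType) (A : lmodType R).

Local Notation comb := (seq (R * seq A)).

Inductive tcong : comb -> comb -> Prop :=
| tcong_refl x : tcong x x
| tcong_sym x y : tcong x y -> tcong y x
| tcong_trans x y z : tcong x y -> tcong y z -> tcong x z
| tcong_cat x x' y y' : tcong x x' -> tcong y y' -> tcong (x ++ y) (x' ++ y')
| tcong_catC x y : tcong (x ++ y) (y ++ x)
| tcong_zero w : tcong [:: (0, w)] [::]
| tcong_add r s w : tcong [:: (r + s, w)] [:: (r, w); (s, w)]
| tcong_letter r u k a b v :
    tcong [:: (r, u ++ (k *: a + b) :: v)]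
          [:: (r * k, u ++ a :: v); (r, u ++ b :: v)].

Definition tequiv (x y : comb) : bool := `[< tcong x y >].

Lemma tequiv_is_equiv : equiv_class_of tequiv.
Proof.
split=> [x|x y|y x z]; first by apply/asboolP; exact: tcong_refl.
  by apply/asboolP/asboolP; exact: tcong_sym.
by move=> /asboolP h1 /asboolP h2; apply/asboolP; exact: tcong_trans h1 h2.
Qed.

Canonical tequiv_equiv := EquivRelPack tequiv_is_equiv.
Canonical tequiv_encModRel := defaultEncModRel tequiv.

Definition tensor := {eq_quot tequiv}.
HB.instance Definition _ := Choice.on tensor.
HB.instance Definition _ : EqQuotient _ tequiv tensor := EqQuotient.on tensor.

Definition tcls (x : comb) : tensor := \pi_tensor x.

Lemma tclsP x y : tcls x = tcls y <-> tcong x y.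
Proof.
split=> [/eqP|h]; first by rewrite /tcls piE => /asboolP.
by apply/eqP; rewrite /tcls piE; apply/asboolP.
Qed.

Lemma tclsK (x : tensor) : tcls (repr x) = x.
Proof. exact: reprK. Qed.

Lemma tcls_ind (P : tensor -> Prop) : (forall x, P (tcls x)) -> forall x, P x.
Proof. by move=> h x; rewrite -(tclsK x). Qed.

Definition cscale (k : R) (x : comb) : comb := [seq (k * c.1, c.2) | c <- x].

Definition tadd (x y : tensor) := tcls (repr x ++ repr y).
Definition tscale k (x : tensor) := tcls (cscale k (repr x)).
Definition tzero := tcls [::].
Definition topp := tscale (-1).

Lemma tcong_repr x : tcong (repr (tcls x)) x.
Proof. by apply/tclsP; rewrite tclsK. Qed.

Lemma tcong_scale k x y : tcong x y -> tcong (cscale k x) (cscale k y).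
Proof.
elim=> {x y} [x|x y _|x y z _ h1 _|x x' y y' _ h1 _ h2|x y|w|r s w|r u l a b v].
- exact: tcong_refl.
- exact: tcong_sym.
- exact: tcong_trans h1.
- by rewrite /cscale !map_cat; exact: tcong_cat.
- by rewrite /cscale !map_cat; exact: tcong_catC.
- by rewrite /= mulr0; exact: tcong_zero.
- by rewrite /= mulrDr; exact: tcong_add.
- by rewrite /= mulrA; exact: tcong_letter.
Qed.

Lemma taddE x y : tadd (tcls x) (tcls y) = tcls (x ++ y).
Proof. by apply/tclsP; apply: tcong_cat; exact: tcong_repr. Qed.

Lemma tscaleE k x : tscale k (tcls x) = tcls (cscale k x).
Proof. by apply/tclsP; apply: tcong_scale; exact: tcong_repr. Qed.

Lemma taddA : associative tadd.
Proof.
move=> x y z; elim/tcls_ind: x => x; elim/tcls_ind: y => y.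
by elim/tcls_ind: z => z; rewrite !taddE catA.
Qed.

Lemma taddC : commutative tadd.
Proof.
move=> x y; elim/tcls_ind: x => x; elim/tcls_ind: y => y.
by rewrite !taddE; apply/tclsP; exact: tcong_catC.
Qed.

Lemma tadd0 : left_id tzero tadd.
Proof. by move=> x; elim/tcls_ind: x => x; rewrite taddE. Qed.

Lemma tscale_addl k l x : tscale (k + l) x = tadd (tscale k x) (tscale l x).
Proof.
elim/tcls_ind: x => x; rewrite !tscaleE taddE; apply/tclsP.
elim: x => [|c x IHx] /=; first exact: tcong_refl.
rewrite -[X in tcong X]cat1s.
apply: tcong_trans (tcong_cat (tcong_refl _) IHx) _.
rewrite mulrDl.
apply: tcong_trans (tcong_cat (tcong_add _ _ _) (tcong_refl _)) _.
rewrite -[X in tcong X _]/([:: (k * c.1, c.2)] ++ ([:: (l * c.1, c.2)] ++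
  cscale k x ++ cscale l x)).
rewrite -[X in tcong _ X]/([:: (k * c.1, c.2)] ++ (cscale k x ++
  ([:: (l * c.1, c.2)] ++ cscale l x))).
apply: tcong_cat; first exact: tcong_refl.
by rewrite !catA; apply: tcong_cat; [exact: tcong_catC | exact: tcong_refl].
Qed.

Lemma tscale0 x : tscale 0 x = tzero.
Proof.
elim/tcls_ind: x => x; rewrite tscaleE; apply/tclsP.
elim: x => [|c x IHx] /=; first exact: tcong_refl.
rewrite mul0r -cat1s -[X in tcong _ X]cat0s.
by apply: tcong_cat => //; exact: tcong_zero.
Qed.

Lemma tscale1 : left_id 1 tscale.
Proof.
move=> x; elim/tcls_ind: x => x; rewrite tscaleE /cscale; congr tcls.
by rewrite -[RHS]map_id; apply: eq_map => -[r w]; rewrite mul1r.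
Qed.

Lemma taddN : left_inverse tzero topp tadd.
Proof.
move=> x; rewrite /topp -{2}(tscale1 x) -tscale_addl addNr; exact: tscale0.
Qed.

HB.instance Definition _ :=
  GRing.isZmodule.Build tensor taddA taddC tadd0 taddN.

Lemma tscaleA k l x : tscale k (tscale l x) = tscale (k * l) x.
Proof.
elim/tcls_ind: x => x; rewrite !tscaleE /cscale -map_comp; congr tcls.
by apply: eq_map => c /=; rewrite mulrA.
Qed.

Lemma tscaleDr : right_distributive tscale +%R.
Proof.
move=> k x y; elim/tcls_ind: x => x; elim/tcls_ind: y => y.
by rewrite [x in tscale k x]taddE !tscaleE [RHS]taddE /cscale map_cat.
Qed.

Lemma tscaleDl x : {morph tscale^~ x : k l / k + l}.
Proof. by move=> k l; exact: tscale_addl. Qed.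

HB.instance Definition _ := GRing.Zmodule_isLmodule.Build R tensor
  tscaleA tscale1 tscaleDr tscaleDl.

Lemma add_tcls x y : tcls x + tcls y = tcls (x ++ y).
Proof. exact: taddE. Qed.

Lemma scale_tcls k x : k *: tcls x = tcls (cscale k x).
Proof. exact: tscaleE. Qed.

Definition tmon (w : seq A) : tensor := tcls [:: (1, w)].

Definition multilinear (V : lmodType R) (F : seq A -> V) : Prop :=
  forall u k a b v,
    F (u ++ (k *: a + b) :: v) = k *: F (u ++ a :: v) + F (u ++ b :: v).

Lemma tmon_multilinear : multilinear tmon.
Proof.
move=> u k a b v; rewrite scale_tcls add_tcls; apply/tclsP.
by rewrite /= mulr1; have:= tcong_letter 1 u k a b v; rewrite mul1r.
Qed.

Lemma tcls_sum x : tcls x = \sum_(c <- x) c.1 *: tmon c.2.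
Proof.
elim: x => [|[r w] x IHx]; first by rewrite big_nil.
rewrite big_cons -IHx scale_tcls add_tcls /=.
by rewrite mulr1.
Qed.

(* The linear map out of TA with prescribed values on words (meaningful when
   F is multilinear). *)
Definition tlift (V : lmodType R) (F : seq A -> V) (x : tensor) : V :=
  \sum_(c <- repr x) c.1 *: F c.2.

Section Lift.
Variables (V : lmodType R) (F : seq A -> V).
Hypothesis Fl : multilinear F.

Lemma tlift_cls x : tlift F (tcls x) = \sum_(c <- x) c.1 *: F c.2.
Proof.
have: tcong (repr (tcls x)) x by exact: tcong_repr.
rewrite /tlift; move: (repr _) => y.
elim=> {x y} // [x y z _ -> //|x x' y y' _ h1 _ h2|x y|w|r s w|r u l a b v].
- by rewrite !big_cat h1 h2.
- by rewrite !big_cat /= addrC.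
- by rewrite big_seq1 big_nil scale0r.
- by rewrite !big_cons !big_nil !addr0 scalerDl.
- by rewrite !big_cons !big_nil !addr0 Fl scalerDr scalerA.
Qed.

Lemma tlift_linear : linear (tlift F).
Proof.
move=> k x y; elim/tcls_ind: x => x; elim/tcls_ind: y => y.
rewrite scale_tcls add_tcls !tlift_cls big_cat /=.
rewrite scaler_sumr big_map; congr (_ + _).
by apply: eq_bigr => c _ /=; rewrite scalerA.
Qed.

Lemma tlift_mon w : tlift F (tmon w) = F w.
Proof. by rewrite tlift_cls big_seq1 scale1r. Qed.

End Lift.

End Tensor.

Arguments tmon {R A} w.

Section Graded.
Variables (R : comPzRingType) (A : lmodType R) (hom : int -> A -> Prop).
Hypothesis homP : is_grading hom.

(* Words whose letters carry a degree tag; the tags of a homogeneous word are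
   degrees of its letters. *)
Local Notation tword := (seq (int * A)).

Definition homogeneous (w : tword) : Prop :=
  forall c, c \in w -> hom c.1 c.2.

Definition wdeg (w : tword) : int := \sum_(c <- w) (c.1 + 1).

Definition ttmon (w : tword) : tensor A := tmon (unzip2 w).

Definition thom (k : int) (x : tensor A) : Prop :=
  exists2 s : seq (R * tword),
    forall c, c \in s -> homogeneous c.2 /\ wdeg c.2 = k
    & x = \sum_(c <- s) c.1 *: ttmon c.2.

Fact components_subproof a : exists sc : seq int * (int -> A),
  [/\ uniq sc.1, forall p, hom p (sc.2 p), forall p, p \notin sc.1 -> sc.2 p = 0
    & a = \sum_(p <- sc.1) sc.2 p].
Proof.
have [s [c [us hc ->]]] := grading_sum homP a.
exists (s, fun p => if p \in s then c p else 0); split=> //=.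
- by move=> p; case: ifP => // _; exact: grading0.
- by move=> p /negPf->.
- by apply: eq_big_seq => p ->.
Qed.

Definition supp (a : A) : seq int := (projT1 (cid (components_subproof a))).1.

(* comp p a is the homogeneous component of degree p of a. *)
Definition comp (p : int) (a : A) : A :=
  (projT1 (cid (components_subproof a))).2 p.

Lemma compP a : [/\ uniq (supp a), forall p, hom p (comp p a),
  forall p, p \notin supp a -> comp p a = 0 & a = \sum_(p <- supp a) comp p a].
Proof. by rewrite /supp /comp; case: cid. Qed.

Lemma sum_supp (V : zmodType) (G : int -> A -> V) a (D : seq int) :
  (forall p, G p 0 = 0) -> uniq D -> {subset supp a <= D} ->
  \sum_(p <- supp a) G p (comp p a) = \sum_(p <- D) G p (comp p a).
Proof.
move=> G0 uD sD; have [us _ c0 _] := compP a.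
rewrite [RHS](bigID (mem (supp a))) /= [X in _ + X]big1 ?addr0; last first.
  by move=> p /c0 ->.
rewrite -[RHS]big_filter; apply: perm_big; apply: uniq_perm => //.
  exact: filter_uniq.
move=> p; rewrite mem_filter /=; case ps: (p \in supp a) => //=.
by rewrite sD.
Qed.

Lemma sum_comp a (D : seq int) :
  uniq D -> {subset supp a <= D} -> \sum_(p <- D) comp p a = a.
Proof.
move=> uD sD; have [_ _ _ {2}->] := compP a; symmetry.
exact: (sum_supp (G := fun _ x => x)).
Qed.

Lemma comp_uniq a (D : seq int) (c : int -> A) :
  uniq D -> {subset supp a <= D} -> (forall p, hom p (c p)) ->
  (forall p, p \notin D -> c p = 0) -> a = \sum_(p <- D) c p ->
  forall p, comp p a = c p.
Proof.
move=> uD sD hc c0 ac p; have [us hs cs0 _] := compP a.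
have [pD|pD] := boolP (p \in D); last first.
  by rewrite c0 // cs0 //; apply: contra pD; exact: sD.
apply/eqP; rewrite -subr_eq0; apply/eqP.
apply: (grading_free homP (c := fun p => comp p a - c p) uD _ _ pD).
  by move=> q; rewrite addrC -scaleN1r; exact: gradingP.
by rewrite sumrB -ac sum_comp ?subrr.
Qed.

Lemma comp_linear p : linear (comp p).
Proof.
move=> k a b; have [_ ha a0 _] := compP a; have [_ hb b0 _] := compP b.
pose D := undup (supp a ++ supp b ++ supp (k *: a + b)).
have uD : uniq D by rewrite undup_uniq.
have sa : {subset supp a <= D} by move=> q h; rewrite mem_undup !mem_cat h.
have sb : {subset supp b <= D}.
  by move=> q h; rewrite mem_undup !mem_cat h !orbT.
have sab : {subset supp (k *: a + b) <= D}.
  by move=> q h; rewrite mem_undup !mem_cat h !orbT.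
apply: (comp_uniq (c := fun q => k *: comp q a + comp q b) uD sab).
- by move=> q; exact: gradingP.
- move=> q; rewrite mem_undup !mem_cat !negb_or => /and3P[/a0-> /b0-> _].
  by rewrite scaler0 addr0.
- by rewrite big_split -scaler_sumr /= !sum_comp.
Qed.

Lemma comp_hom p q a : hom p a -> comp q a = if q == p then a else 0.
Proof.
move=> ha; pose D := undup (p :: supp a).
apply: (comp_uniq (D := D) (c := fun q => if q == p then a else 0)).
- exact: undup_uniq.
- by move=> r h; rewrite mem_undup inE h orbT.
- by move=> r; case: eqP => [->|_] //; exact: grading0.
- by move=> r; rewrite mem_undup inE negb_or => /andP[/negPf->].
- rewrite (bigD1_seq p) ?undup_uniq ?mem_undup ?mem_head //= eqxx.
  by rewrite big1 ?addr0 // => r /negPf->.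
Qed.

Definition components (a : A) : tword := [seq (p, comp p a) | p <- supp a].

(* All the homogeneous words obtained by replacing each letter of w by one of
   its homogeneous components; w is their sum in TA. *)
Fixpoint expand (w : seq A) : seq tword :=
  if w is a :: w' then [seq c :: h | c <- components a, h <- expand w']
  else [:: [::]].

(* The linear map out of TA whose value on each homogeneous word h is F h,
   for F linear in every letter (see hlift_mon). *)
Definition hlift (V : lmodType R) (F : tword -> V) : tensor A -> V :=
  tlift (fun w => \sum_(h <- expand w) F h).

Definition hmultilinear (V : lmodType R) (F : tword -> V) : Prop :=
  forall u p k a b v,
    F (u ++ (p, k *: a + b) :: v) =
      k *: F (u ++ (p, a) :: v) + F (u ++ (p, b) :: v).

Lemma expand_sum (V : zmodType) (F : tword -> V) (u : seq A) a v :
  \sum_(h <- expand (u ++ a :: v)) F h =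
  \sum_(h1 <- expand u) \sum_(p <- supp a) \sum_(h2 <- expand v)
    F (h1 ++ (p, comp p a) :: h2).
Proof.
elim: u F => [|b u IHu] F /=.
  by rewrite big_seq1 big_allpairs_dep big_map.
rewrite !big_allpairs_dep; apply: eq_bigr => c _.
by rewrite (IHu (fun h => F (c :: h))).
Qed.

Lemma sum_comp_linear (V : lmodType R) (G : int -> A -> V) :
  (forall p, linear (G p)) -> linear (fun a => \sum_(p <- supp a) G p (comp p a)).
Proof.
move=> Gl k a b; pose D := undup (supp a ++ supp b ++ supp (k *: a + b)).
have G0 p : G p 0 = 0.
  by have := Gl p (-1) 0 0; rewrite scaler0 addr0 scaleN1r addNr.
have uD : uniq D by rewrite undup_uniq.
rewrite !(@sum_supp _ _ _ D G0 uD);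
  try by move=> q h; rewrite mem_undup !mem_cat h ?orbT.
rewrite scaler_sumr -big_split; apply: eq_bigr => p _ /=.
by rewrite comp_linear Gl.
Qed.

Section HLift.
Variables (V : lmodType R) (F : tword -> V).
Hypothesis Fl : hmultilinear F.

Lemma expand_multilinear :
  multilinear (fun w => \sum_(h <- expand w) F h).
Proof.
move=> u k a b v; rewrite !expand_sum scaler_sumr -big_split.
apply: eq_bigr => h1 _.
apply: (sum_comp_linear (G := fun p x =>
  \sum_(h2 <- expand v) F (h1 ++ (p, x) :: h2))).
move=> p l x y; rewrite scaler_sumr -big_split.
by apply: eq_bigr => h2 _; exact: Fl.
Qed.

Lemma hlift_cls x :
  hlift F (tcls x) = \sum_(c <- x) c.1 *: \sum_(h <- expand c.2) F h.
Proof. exact: tlift_cls expand_multilinear _. Qed.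

Lemma hlift_linear : linear (hlift F).
Proof. exact: tlift_linear expand_multilinear. Qed.

End HLift.

Lemma expand_homogeneous (V : lmodType R) (F : tword -> V) h :
  hmultilinear F -> homogeneous h -> \sum_(h' <- expand (unzip2 h)) F h' = F h.
Proof.
elim: h F => [|[p a] h IHh] F Fl hh /=; first by rewrite big_seq1.
have ha : hom p a by apply: (hh (p, a)); rewrite mem_head.
have hh' : homogeneous h by move=> c ch; apply: hh; rewrite inE ch orbT.
have Gl q : linear (fun x => F ((q, x) :: h)) by move=> k x y; exact: (Fl [::]).
rewrite big_allpairs_dep big_map /=.
have E c : \sum_(h' <- expand (unzip2 h)) F (c :: h') = F (c :: h).
  by apply: (IHh (fun h' => F (c :: h'))) hh' => u; exact: (Fl (c :: u)).
under eq_bigr => q _ do rewrite E.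
rewrite (@sum_supp _ (fun q x => F ((q, x) :: h)) _ (undup (p :: supp a))).
- rewrite (bigD1_seq p) ?undup_uniq ?mem_undup ?mem_head //=.
  rewrite (comp_hom _ ha) eqxx big1 ?addr0 // => q qp.
  rewrite (comp_hom _ ha) (negPf qp).
  by have := Gl q (-1) 0 0; rewrite scaler0 addr0 scaleN1r addNr.
- by move=> q; have := Gl q (-1) 0 0; rewrite scaler0 addr0 scaleN1r addNr.
- exact: undup_uniq.
- by move=> r q; rewrite mem_undup inE q orbT.
Qed.

Lemma hlift_mon (V : lmodType R) (F : tword -> V) h :
  hmultilinear F -> homogeneous h -> hlift F (ttmon h) = F h.
Proof.
move=> Fl hh; rewrite /hlift /ttmon tlift_mon; last exact: expand_multilinear.
exact: expand_homogeneous.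
Qed.

End Graded.

(* dw, Deltaw and shufw are the defining formulas on homogeneous words (letters
   are numbered from 0, so that wdeg (take i.+1 w) - 1 is |a_0| + .. + |a_i| + i);
   d, Delta and the shuffle product on TA are their (bi)linear extensions, as
   TA_d_mon, TA_Delta_mon, TA_shuffle_mon and the linearity lemmas confirm. *)
Section Operations.
Variables (R : comPzRingType) (A : dgAlgebra R).

Local Notation tword := (seq (int * A)).
Local Notation letter w i := (nth 0 (unzip2 w) i).

Definition dw (w : tword) : tensor A :=
  \sum_(i < size w) sgn R (wdeg (take i w)) *:
    tmon (take i (unzip2 w) ++ dga_d (letter w i) :: drop i.+1 (unzip2 w)).

Definition Deltaw (w : tword) : tensor A :=
  \sum_(i < (size w).-1) sgn R (wdeg (take i.+1 w) - 1) *: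
    tmon (take i (unzip2 w)
          ++ dga_mu (letter w i) (letter w i.+1) :: drop i.+2 (unzip2 w)).

Definition is_shuffle n m (s : 'S_(n + m)) : bool :=
  [forall i : 'I_(n + m), forall j : 'I_(n + m),
    (i < j)%N && ((j < n)%N || (n <= i)%N) ==> (s i < s j)%N].

(* The exponent kappa; deg i is the degree of the i-th letter. *)
Definition koszul N (deg : nat -> int) (s : 'S_N) : int :=
  \sum_(i < N) \sum_(j < N | (i < j)%N && (s j < s i)%N)
    (deg i + 1) * (deg j + 1).

Definition shufw (u v : tword) : tensor A :=
  \sum_(s : 'S_(size u + size v) | is_shuffle s)
    sgn R (koszul (nth 0 (unzip1 (u ++ v))) s) *:
    tmon [seq letter (u ++ v) ((s^-1)%g i) | i <- enum 'I_(size u + size v)].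

Lemma wdegE (w : tword) : wdeg w = \sum_(q <- unzip1 w) (q + 1).
Proof. by rewrite /wdeg big_map. Qed.

Lemma tmon_slot (u v : seq A) k a b :
  tmon (u ++ (k *: a + b) :: v) =
  k *: tmon (u ++ a :: v) + tmon (u ++ b :: v).
Proof. exact: tmon_multilinear. Qed.

Lemma slot_sum (V : lmodType R) (I : Type) (r : seq I) (P : pred I)
    (e : I -> R) (x y z : I -> V) k :
  (forall i, P i -> x i = k *: y i + z i) ->
  \sum_(i <- r | P i) e i *: x i =
  k *: (\sum_(i <- r | P i) e i *: y i) + \sum_(i <- r | P i) e i *: z i.
Proof.
move=> E; rewrite scaler_sumr -big_split; apply: eq_bigr => i /E ->.
by rewrite scalerDr !scalerA mulrC.
Qed.

Lemma split_seq (T : Type) (s : seq T) i : (i < size s)%N ->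
  exists s1 y s2, s = s1 ++ y :: s2 /\ size s1 = i.
Proof.
case: s => [//|y0 s] h.
exists (take i (y0 :: s)), (nth y0 (y0 :: s) i), (drop i.+1 (y0 :: s)).
by rewrite -drop_nth // cat_take_drop size_takel // ltnW.
Qed.

Lemma drop_slot (T : Type) (s1 s2 : seq T) y :
  drop (size s1).+1 (s1 ++ y :: s2) = s2.
Proof. by rewrite -cat_rcons drop_size_cat // size_rcons. Qed.

Lemma nth_slot (T : Type) (x0 : T) (s1 s2 : seq T) y :
  nth x0 (s1 ++ y :: s2) (size s1) = y.
Proof. by rewrite nth_cat ltnn subnn. Qed.

Let dterm i (w : seq A) :=
  tmon (take i w ++ dga_d (nth 0 w i) :: drop i.+1 w).

Let dtermE s1 y s2 : dterm (size s1) (s1 ++ y :: s2) = tmon (s1 ++ dga_d y :: s2).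
Proof. by rewrite /dterm take_size_cat // nth_slot drop_slot. Qed.

Let dterm_slot u k (a b : A) v i : (i < size u + (size v).+1)%N ->
  dterm i (u ++ (k *: a + b) :: v) =
  k *: dterm i (u ++ a :: v) + dterm i (u ++ b :: v).
Proof.
move=> iuv; have [iu|ui|->] := ltngtP i (size u).
- have [s1 [y [s2 [-> <-]]]] := split_seq iu.
  by rewrite -!catA !dtermE -!cat_cons !catA tmon_slot.
- have [|s1 [y [s2 [-> e]]]] := @split_seq _ v (i - (size u).+1)%N.
    by rewrite ltn_subLR // addSnnS.
  have E x : i = size (u ++ x :: s1) by rewrite size_cat /= e addnS -addSn subnKC.
  rewrite -!cat_cons !catA {1}(E (k *: a + b)) {1}(E a) {1}(E b) !dtermE -!catA.
  by rewrite tmon_slot.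
- by rewrite !dtermE (dga_d_linear (dga_axioms A)) tmon_slot.
Qed.

Lemma dw_multilinear : hmultilinear dw.
Proof.
move=> u p k a b v; rewrite /dw.
have E x : \sum_(i < size (u ++ (p, x) :: v))
    sgn R (wdeg (take i (u ++ (p, x) :: v))) *:
    dterm i (unzip2 (u ++ (p, x) :: v)) =
  \sum_(i < size u + (size v).+1)
    sgn R (\sum_(q <- take i (unzip1 u ++ p :: unzip1 v)) (q + 1)) *:
    dterm i (unzip2 u ++ x :: unzip2 v).
  rewrite size_cat; apply: eq_bigr => i _.
  by rewrite wdegE /unzip1 map_take /unzip2 !map_cat.
rewrite !E; apply: slot_sum => i _; apply: dterm_slot.
by rewrite !size_map.
Qed.

Let Dterm i (w : seq A) :=
  tmon (take i w ++ dga_mu (nth 0 w i) (nth 0 w i.+1) :: drop i.+2 w).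

Let DtermE s1 y z s2 :
  Dterm (size s1) (s1 ++ y :: z :: s2) = tmon (s1 ++ dga_mu y z :: s2).
Proof.
rewrite /Dterm take_size_cat // nth_slot -(cat_rcons y) -(size_rcons s1 y).
by rewrite nth_slot drop_slot.
Qed.

Let Dterm_slot u k (a b : A) v i : (i.+1 < size u + (size v).+1)%N ->
  Dterm i (u ++ (k *: a + b) :: v) =
  k *: Dterm i (u ++ a :: v) + Dterm i (u ++ b :: v).
Proof.
move=> iuv; have [iu|ui|eui] := ltngtP i.+1 (size u).
- have [s1 [y [s2 [eu es]]]] := split_seq (ltnW iu).
  case: s2 eu => [|z s2] eu.
    by move: iu; rewrite eu size_cat /= es addn1 ltnn.
  by rewrite eu -es -!catA !DtermE -!cat_cons !catA tmon_slot.
- move: ui; rewrite ltnS leq_eqVlt => /predU1P[eui|ui].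
    case: v iuv => [|z v]; first by rewrite addn1 eui ltnn.
    by rewrite -eui !DtermE (dga_mu_linearl (dga_axioms A)) tmon_slot.
  have [|s1 [y [s2 [ev e]]]] := @split_seq _ v (i - (size u).+1)%N.
    by rewrite ltn_subLR // addSnnS ltnW.
  have E x : i = size (u ++ x :: s1) by rewrite size_cat /= e addnS -addSn subnKC.
  case: s2 ev => [|z s2] ev.
    move: iuv; rewrite ev size_cat /= e addn1 !addnS -addSn subnKC //.
    by rewrite ltnn.
  rewrite ev -!cat_cons !catA {1}(E (k *: a + b)) {1}(E a) {1}(E b).
  by rewrite !DtermE -!catA tmon_slot.
- case/lastP: u eui {iuv} => [//|u y]; rewrite size_rcons => -[->].
  by rewrite !cat_rcons !DtermE (dga_mu_linearr (dga_axioms A)) tmon_slot.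
Qed.

Lemma Deltaw_multilinear : hmultilinear Deltaw.
Proof.
move=> u p k a b v; rewrite /Deltaw.
have E x : \sum_(i < (size (u ++ (p, x) :: v)).-1)
    sgn R (wdeg (take i.+1 (u ++ (p, x) :: v)) - 1) *:
    Dterm i (unzip2 (u ++ (p, x) :: v)) =
  \sum_(i < (size u + (size v).+1).-1)
    sgn R (\sum_(q <- take i.+1 (unzip1 u ++ p :: unzip1 v)) (q + 1) - 1) *:
    Dterm i (unzip2 u ++ x :: unzip2 v).
  rewrite size_cat; apply: eq_bigr => i _.
  by rewrite wdegE /unzip1 map_take /unzip2 !map_cat.
rewrite !E; apply: slot_sum => i _; apply: Dterm_slot.
by rewrite !size_map; move: (ltn_ord i); rewrite -ltnS prednK // addnS.
Qed.

Let perm_word N (s : 'S_N) (w : seq A) :=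
  [seq nth 0 w ((s^-1)%g i) | i <- enum 'I_N].

Let perm_slot N (s : 'S_N) u k (a b : A) v : N = (size u + (size v).+1)%N ->
  tmon (perm_word s (u ++ (k *: a + b) :: v)) =
  k *: tmon (perm_word s (u ++ a :: v)) + tmon (perm_word s (u ++ b :: v)).
Proof.
move=> eN; have uN : (size u < N)%N by rewrite eN addnS ltnS leq_addr.
pose j := s (Ordinal uN).
have jE : mem (enum 'I_N) j by rewrite /= mem_enum.
have [s1 [s2 [es j1 j2]]] : exists s1 s2,
    [/\ enum 'I_N = s1 ++ j :: s2, j \notin s1 & j \notin s2].
  case/splitPr: (jE) (enum_uniq 'I_N) => s1 s2; rewrite cat_uniq /=.
  case/and4P => _ /norP[j1 _] j2 _.
  by exists s1, s2.
have E x : perm_word s (u ++ x :: v) =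
    [seq nth 0 (u ++ 0 :: v) ((s^-1)%g i) | i <- s1] ++
    x :: [seq nth 0 (u ++ 0 :: v) ((s^-1)%g i) | i <- s2].
  have F t : j \notin t -> [seq nth 0 (u ++ x :: v) ((s^-1)%g i) | i <- t] =
      [seq nth 0 (u ++ 0 :: v) ((s^-1)%g i) | i <- t].
    move=> jt; apply/eq_in_map => i it; rewrite !nth_cat.
    case: ltngtP => // [h|h]; first by rewrite -(subnKC h) addSnnS addKn.
    case/negP: jt; suff -> : j = i by [].
    by rewrite /j; apply: (canLR (permKV s)); apply: val_inj; rewrite /= -h.
  rewrite /perm_word es map_cat /= !F // permK /=.
  by rewrite nth_slot.
by rewrite !E tmon_slot.
Qed.

Lemma shufw_multilinearl v : hmultilinear (shufw^~ v).
Proof.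
move=> u p k a b u'; rewrite /shufw.
have E x :
  \sum_(s : 'S_(size (u ++ (p, x) :: u') + size v) | is_shuffle s)
    sgn R (koszul (nth 0 (unzip1 ((u ++ (p, x) :: u') ++ v))) s) *:
    tmon (perm_word s (unzip2 ((u ++ (p, x) :: u') ++ v))) =
  \sum_(s : 'S_((size u + (size u').+1) + size v) | is_shuffle s)
    sgn R (koszul (nth 0 (unzip1 u ++ p :: unzip1 (u' ++ v))) s) *:
    tmon (perm_word s (unzip2 u ++ x :: unzip2 (u' ++ v))).
  rewrite size_cat; apply: eq_bigr => s _.
  by rewrite -catA /unzip1 /unzip2 !map_cat.
rewrite !E; apply: slot_sum => s _; apply: perm_slot.
by rewrite !size_map size_cat -addnA.
Qed.

Lemma shufw_multilinearr u : hmultilinear (shufw u).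
Proof.
move=> v p k a b v'; rewrite /shufw.
have E x :
  \sum_(s : 'S_(size u + size (v ++ (p, x) :: v')) | is_shuffle s)
    sgn R (koszul (nth 0 (unzip1 (u ++ v ++ (p, x) :: v'))) s) *:
    tmon (perm_word s (unzip2 (u ++ v ++ (p, x) :: v'))) =
  \sum_(s : 'S_(size u + (size v + (size v').+1)) | is_shuffle s)
    sgn R (koszul (nth 0 (unzip1 (u ++ v) ++ p :: unzip1 v')) s) *:
    tmon (perm_word s (unzip2 (u ++ v) ++ x :: unzip2 v')).
  rewrite size_cat; apply: eq_bigr => s _.
  by rewrite catA /unzip1 /unzip2 !map_cat.
rewrite !E; apply: slot_sum => s _; apply: perm_slot.
by rewrite !size_map size_cat -addnA.
Qed.

Let homP := dga_grading (dga_axioms A).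

Definition TA_hom : int -> tensor A -> Prop := thom (@dga_hom R A).

Definition TA_d : tensor A -> tensor A := hlift homP dw.

Definition TA_Delta : tensor A -> tensor A := hlift homP Deltaw.

Definition TA_shuffle (x y : tensor A) : tensor A :=
  hlift homP (fun u => hlift homP (shufw u) y) x.

Local Notation homogeneous := (homogeneous (@dga_hom R A)).

Lemma TA_d_mon w : homogeneous w -> TA_d (ttmon w) = dw w.
Proof. exact: hlift_mon dw_multilinear. Qed.

Lemma TA_Delta_mon w : homogeneous w -> TA_Delta (ttmon w) = Deltaw w.
Proof. exact: hlift_mon Deltaw_multilinear. Qed.

Lemma TA_d_linear : linear TA_d.
Proof. exact: hlift_linear dw_multilinear. Qed.

Lemma TA_Delta_linear : linear TA_Delta.
Proof. exact: hlift_linear Deltaw_multilinear. Qed.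

Let shuf_multilinear y : hmultilinear (fun u => hlift homP (shufw u) y).
Proof.
move=> u p k a b u'; elim/tcls_ind: y => y.
rewrite !hlift_cls; try exact: shufw_multilinearr.
apply: slot_sum => c _; rewrite scaler_sumr -big_split; apply: eq_bigr => h _.
exact: shufw_multilinearl.
Qed.

Lemma TA_shuffle_mon u v : homogeneous u -> homogeneous v ->
  TA_shuffle (ttmon u) (ttmon v) = shufw u v.
Proof.
move=> hu hv; rewrite /TA_shuffle hlift_mon // hlift_mon //.
exact: shufw_multilinearr.
Qed.

Lemma TA_shuffle_linearl y : linear (TA_shuffle^~ y).
Proof. exact: hlift_linear (shuf_multilinear y). Qed.

Lemma TA_shuffle_linearr x : linear (TA_shuffle x).
Proof.
move=> k y z; elim/tcls_ind: x => x; rewrite /TA_shuffle.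
rewrite !(hlift_cls homP (shuf_multilinear _)).
apply: slot_sum => c _; rewrite scaler_sumr -big_split; apply: eq_bigr => h _.
exact: (hlift_linear homP (shufw_multilinearr h)).
Qed.

End Operations.

(* The sum of the f^(x)n, for f linear (see TA_map_mon). *)
Definition TA_map (R : comPzRingType) (A B : lmodType R) (f : A -> B) :
    tensor A -> tensor B := tlift (fun w => tmon (map f w)).

Lemma TA_map_mon (R : comPzRingType) (A B : lmodType R) (f : A -> B) w :
  linear f -> TA_map f (tmon w) = tmon (map f w).
Proof.
move=> fl; apply: tlift_mon => u k a b v.
by rewrite !map_cat /= fl tmon_multilinear.
Qed.

(* Main.v *)
Require Import Defs.
From mathcomp Require Import all_boot all_order all_algebra perm ring zify.

Set Implicit Arguments.
Unset Strict Implicit.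
Unset Printing Implicit Defensive.

Import GRing.Theory.
Local Open Scope ring_scope.

(** Write [a.x] for the word or tensor x with the letter a put in front, and M_a
    for the operator that multiplies a into the first letter, so that
    M_a (b.x) = (ab).x, and kills the empty word.  Each operation is determined
    by a recursion on first letters: for |a| = q, |b| = r and x of total degree
    p,
      d (a.x) = (d a).x + (-1)^(q+1) a.(d x),
      Delta (a.x) = (-1)^q (M_a x - a.(Delta x)),
      a.x * b.y = a.(x * b.y) + (-1)^((r+1)(q+1+p)) b.(a.x * y).
    The first two are read off the formulas ([TA_d_cons], [TA_Delta_cons]).  The
    third ([TA_shuffle_cons]) sorts the shuffles s of two nonempty words by the
    position i that s sends to 0: it is the start of one of the two words, and
    removing it leaves a shuffle of what remains, the sign being the price of
    moving the letter at i to the front.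

    After this, permutations disappear.  Homogeneous elements are generated by
    the empty word under concatenation of homogeneous letters and linear
    combinations ([thom_ind]), and the identities are proved by that induction,
    each time expanding both sides with the recursions and comparing
    coefficients.
    For the two differentials the identities needed are the differential graded
    algebra axioms in operator form: d M_a = M_(da) + (-1)^q M_a d is the
    derivation property and M_a M_b = M_(ab) is associativity.

    The Leibniz rule for the bracket says that Delta is a second order operator:
    two letters that Delta merges inside a shuffle of x and y are adjacent, so
    either they come from the same factor, where they were adjacent already, or
    one comes from x and the other from y.  The bracket collects the terms of
    the second kind, so it is a shuffle with one merger across the factors, and
    it obeys a recursion of its own ([bracket_cons]):
      {a.x, b.y} = a.{x, b.y} +- b.{a.x, y} +- (ab).(x * y) +- (ba).(x * y).
    A merger of z with a shuffle of x and y merges a letter of z with one of x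
    or with one of y; by induction with this recursion, that is the Leibniz
    rule ([TA_bracket_leibniz]).  The symmetry of the bracket is formal from the
    graded commutativity of the shuffle product.

    A morphism of differential graded algebras commutes with concatenation and
    with M, hence, by the recursions, with all the operations.

    The degrees enter the signs only through their parities, so these
    comparisons of coefficients are decided by trying every choice of parities
    ([leval_signs]). *)

(** * Deciding linear identities with signs *)

Definition oddz (p : int) : bool := odd `|p|%N.

Lemma oddzN p : oddz (- p) = oddz p.
Proof. by rewrite /oddz abszN. Qed.

Lemma oddzD p q : oddz (p + q) = oddz p (+) oddz q.
Proof. by rewrite /oddz; lia. Qed.

Lemma oddzM p q : oddz (p * q) = oddz p && oddz q.
Proof. by rewrite /oddz abszM oddM. Qed.

Lemma sgnE (R : comPzRingType) p : sgn R p = (-1) ^+ oddz p.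
Proof. by rewrite /sgn signr_odd. Qed.

Lemma sgn0 (R : comPzRingType) : sgn R 0 = 1.
Proof. exact: expr0. Qed.

Lemma sgnD (R : comPzRingType) p q : sgn R (p + q) = sgn R p * sgn R q.
Proof. by rewrite !sgnE oddzD signr_addb. Qed.

(** The scalars are left abstract so that one syntax serves two decisions: they
    are elements of the ring in [lin_ring], and degrees p standing for the signs
    (-1)^p in [lin_signs]. *)
Inductive lexp (S : Type) :=
  LZero | LAtom of nat | LAdd of lexp S & lexp S | LOpp of lexp S
| LScale of S & lexp S.
Arguments LZero {S}.
Arguments LAtom {S} n.

Section LinearExpressions.
Variables (R : comPzRingType) (V : lmodType R) (S : Type) (sc : S -> R).

Fixpoint leval (env : seq V) (e : lexp S) : V :=
  match e with
  | LZero => 0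
  | LAtom n => nth 0 env n
  | LAdd e1 e2 => leval env e1 + leval env e2
  | LOpp e1 => - leval env e1
  | LScale r e1 => sc r *: leval env e1
  end.

Fixpoint lcoef (i : nat) (e : lexp S) : R :=
  match e with
  | LZero => 0
  | LAtom n => if n == i then 1 else 0
  | LAdd e1 e2 => lcoef i e1 + lcoef i e2
  | LOpp e1 => - lcoef i e1
  | LScale r e1 => sc r * lcoef i e1
  end.

Fixpoint lcoef_eq (n : nat) (e1 e2 : lexp S) : Prop :=
  if n is n'.+1 then lcoef n' e1 = lcoef n' e2 /\ lcoef_eq n' e1 e2 else True.

Lemma leval_coef env e :
  leval env e = \sum_(i < size env) lcoef i e *: nth 0 env i.
Proof.
elim: e => [|n|e1 IH1 e2 IH2|e1 IH|r e1 IH] /=.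
- by rewrite big1 // => i _; rewrite scale0r.
- case: (ltnP n (size env)) => [lt_n|le_n].
    rewrite (bigD1 (Ordinal lt_n)) //= eqxx scale1r big1 ?addr0 // => i.
    by rewrite -val_eqE /= eq_sym => /negPf->; rewrite scale0r.
  rewrite nth_default // big1 // => i _; rewrite gtn_eqF ?scale0r //.
  exact: leq_trans (ltn_ord i) le_n.
- by rewrite IH1 IH2 -big_split; apply: eq_bigr => i _; rewrite scalerDl.
- by rewrite IH -sumrN; apply: eq_bigr => i _; rewrite scaleNr.
- by rewrite IH scaler_sumr; apply: eq_bigr => i _; rewrite scalerA.
Qed.

Lemma leval_eq env e1 e2 :
  lcoef_eq (size env) e1 e2 -> leval env e1 = leval env e2.
Proof.
rewrite !leval_coef; elim: (size env) => [|n IHn] /=.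
  by rewrite !big_ord0.
by case=> E /IHn{}IHn; rewrite !big_ord_recr /= IHn E.
Qed.

End LinearExpressions.

Inductive dexp :=
  DVar of nat | DZero | DOne | DOpp of dexp | DAdd of dexp & dexp
| DMul of dexp & dexp.

Fixpoint deval (ps : seq int) (e : dexp) : int :=
  match e with
  | DVar n => nth 0 ps n
  | DZero => 0
  | DOne => 1
  | DOpp e1 => - deval ps e1
  | DAdd e1 e2 => deval ps e1 + deval ps e2
  | DMul e1 e2 => deval ps e1 * deval ps e2
  end.

Fixpoint dodd (bs : seq bool) (e : dexp) : bool :=
  match e with
  | DVar n => nth false bs n
  | DZero => false
  | DOne => true
  | DOpp e1 => dodd bs e1
  | DAdd e1 e2 => dodd bs e1 (+) dodd bs e2
  | DMul e1 e2 => dodd bs e1 && dodd bs e2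
  end.

Lemma dodd_deval ps e : oddz (deval ps e) = dodd (map oddz ps) e.
Proof.
elim: e => //= [n|e IH|e1 IH1 e2 IH2|e1 IH1 e2 IH2].
- by elim: ps n => [|p ps IHps] [|n] //=; rewrite IHps.
- by rewrite oddzN IH.
- by rewrite oddzD IH1 IH2.
- by rewrite oddzM IH1 IH2.
Qed.

(** Once the parities bs of the degree variables are chosen, every coefficient
    is an integer, whatever the ring. *)
Fixpoint scoef (bs : seq bool) (i : nat) (e : lexp dexp) : int :=
  match e with
  | LZero => 0
  | LAtom n => if n == i then 1 else 0
  | LAdd e1 e2 => scoef bs i e1 + scoef bs i e2
  | LOpp e1 => - scoef bs i e1
  | LScale p e1 => if dodd bs p then - scoef bs i e1 else scoef bs i e1
  end.

Fixpoint parities (n : nat) : seq (seq bool) :=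
  if n is n'.+1 then
    [seq true :: bs | bs <- parities n'] ++
    [seq false :: bs | bs <- parities n']
  else [:: [::]].

Definition scoef_eq n m (e1 e2 : lexp dexp) : bool :=
  all (fun bs => all (fun i => scoef bs i e1 == scoef bs i e2) (iota 0 m))
    (parities n).

Section SignedExpressions.
Variables (R : comPzRingType) (V : lmodType R) (ps : seq int).

Lemma lcoef_scoef i e :
  lcoef (fun p => sgn R (deval ps p)) i e = (scoef (map oddz ps) i e)%:~R.
Proof.
elim: e => //= [n|e1 -> e2 ->|e1 ->|p e1 ->]; first by case: ifP.
- by rewrite rmorphD.
- by rewrite rmorphN.
rewrite sgnE dodd_deval; case: ifP => _; last by rewrite mul1r.
by rewrite mulN1r rmorphN.
Qed.

(** The signs are determined by the parities of the degrees, so an identity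
    holds in every module as soon as it holds over the integers for each of the
    finitely many choices of parities. The sizes are arguments so that
    evaluating the check does not evaluate the atoms themselves. *)
Lemma leval_signs n m env e1 e2 :
  size ps = n -> size env = m -> scoef_eq n m e1 e2 ->
  leval (fun p => sgn R (deval ps p)) env e1 =
  leval (fun p => sgn R (deval ps p)) env e2 :> V.
Proof.
move=> <- <- /allP/(_ (map oddz ps)) H; rewrite !leval_coef.
apply: eq_bigr => i _; rewrite !lcoef_scoef; congr (_%:~R *: _); apply/eqP.
move: (i : nat) (ltn_ord i) => j ji.
apply: (allP (H _)); last by rewrite mem_iota.
elim: {H ji} ps => //= p ps' IH; rewrite mem_cat; apply/orP.
by case: (oddz p); [left|right]; apply: map_f.
Qed.

End SignedExpressions.

Ltac add_atom env e :=
  let rec mem l := lazymatch l with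
    | nil => constr:(false)
    | ?h :: ?t => match l with
       | _ => let _ := match l with _ => constr_eq h e end in constr:(true)
       | _ => mem t end end in
  lazymatch mem env with true => env | false => constr:(e :: env) end.

Ltac atom_index env e :=
  lazymatch env with
  | ?h :: ?t => match env with
     | _ => let _ := match env with _ => constr_eq h e end in constr:(0%N)
     | _ => let n := atom_index t e in constr:(n.+1) end
  end.

Ltac vector_atoms env e :=
  lazymatch e with
  | 0 => env
  | ?x + ?y => let env := vector_atoms env x in vector_atoms env y
  | - ?x => vector_atoms env x
  | _ *: ?x => vector_atoms env x
  | _ => add_atom env e
  end.

Ltac degree_atoms env p :=
  lazymatch p with
  | 0 => env
  | 1 => env
  | ?x + ?y => let env := degree_atoms env x in degree_atoms env y
  | ?x * ?y => let env := degree_atoms env x in degree_atoms env y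
  | - ?x => degree_atoms env x
  | _ => add_atom env p
  end.

Ltac sign_atoms env e :=
  lazymatch e with
  | ?x + ?y => let env := sign_atoms env x in sign_atoms env y
  | - ?x => sign_atoms env x
  | sgn _ ?p *: ?x => let env := degree_atoms env p in sign_atoms env x
  | _ => env
  end.

Ltac reify_degree env p :=
  lazymatch p with
  | 0 => constr:(DZero)
  | 1 => constr:(DOne)
  | ?x + ?y => let a := reify_degree env x in let b := reify_degree env y in
               constr:(DAdd a b)
  | ?x * ?y => let a := reify_degree env x in let b := reify_degree env y in
               constr:(DMul a b)
  | - ?x => let a := reify_degree env x in constr:(DOpp a)
  | _ => let n := atom_index env p in constr:(DVar n)
  end.

Ltac reify_vector S scalar env e :=
  lazymatch e with
  | 0 => constr:(@LZero S)
  | ?x + ?y => let a := reify_vector S scalar env x in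
               let b := reify_vector S scalar env y in
               constr:(LAdd a b)
  | - ?x => let a := reify_vector S scalar env x in constr:(LOpp a)
  | ?r *: ?x => let a := reify_vector S scalar env x in
                let k := scalar r in constr:(LScale k a)
  | _ => let n := atom_index env e in constr:(@LAtom S n)
  end.

(* For identities in which the scalars need only be commuted and regrouped. *)
Ltac lin_ring :=
  lazymatch goal with
  | |- @eq ?V ?lhs ?rhs =>
    let env := vector_atoms (@nil V) lhs in
    let env := vector_atoms env rhs in
    let R := lazymatch goal with R : GRing.ComPzRing.type |- _ => R end in
    let scalar r := r in
    let a := reify_vector R scalar env lhs in
    let b := reify_vector R scalar env rhs in
    refine (@leval_eq R _ _ id env a b _); rewrite /=; repeat split; ring
  end.

(* For identities in which all scalars are signs (-1)^p, with p a polynomial in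
   the degrees. *)
Ltac lin_signs :=
  lazymatch goal with
  | |- @eq ?V ?lhs ?rhs =>
    let env := vector_atoms (@nil V) lhs in
    let env := vector_atoms env rhs in
    let ps := sign_atoms (@nil int) lhs in
    let ps := sign_atoms ps rhs in
    let R := lazymatch goal with R : GRing.ComPzRing.type |- _ => R end in
    let scalar r := lazymatch r with sgn _ ?p => reify_degree ps p end in
    let a := reify_vector dexp scalar env lhs in
    let b := reify_vector dexp scalar env rhs in
    let n := eval cbv [size] in (size ps) in
    let m := eval cbv [size] in (size env) in
    refine (@leval_signs R _ ps n m env a b erefl erefl _);
    vm_compute; reflexivity
  end.

(** A package of rewrite rules. The rule for opposites comes before the rule
    for scalars because in a tensor module - x is by definition (-1) *: x, and
    would be rewritten as such. *)
Definition linear_rules (R : comPzRingType) (U V : lmodType R) (f : U -> V) :=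
  (((forall x y, f (x + y) = f x + f y)%R * (forall x, f (- x) = - f x)%R)
   * ((forall k x, f (k *: x) = k *: f x)%R * (f 0 = 0)%R))%type.

Lemma linear_rulesP (R : comPzRingType) (U V : lmodType R) (f : U -> V) :
  linear f -> linear_rules f.
Proof.
move=> fl; have f0 : f 0 = 0.
  by have := fl (-1) 0 0; rewrite scaler0 addr0 scaleN1r addNr.
have fZ k x : f (k *: x) = k *: f x by rewrite -[k *: x]addr0 fl f0 addr0.
split; split=> //; first by move=> x y; rewrite -[x]scale1r fl !scale1r.
by move=> x; rewrite -scaleN1r fZ scaleN1r.
Qed.

(** * Words, concatenation of a letter and merging into the first letter *)

Section Words.
Variables (R : comPzRingType) (A : lmodType R).
Local Notation T := (tensor A).

Definition tone : T := tmon [::].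

Definition tcons (a : A) : T -> T := tlift (fun w => tmon (a :: w)).

Let tcons_multilinear a : multilinear (fun w => tmon (a :: w) : T).
Proof. by move=> u; exact: (tmon_multilinear (a :: u)). Qed.

Lemma tcons_mon a w : tcons a (tmon w) = tmon (a :: w).
Proof. exact: tlift_mon. Qed.

Lemma tcons_linear a : linear (tcons a).
Proof. exact: tlift_linear. Qed.

Definition tcons_rules a := linear_rulesP (tcons_linear a).

Lemma tensor_span (P : T -> Prop) :
  P 0 -> (forall k x y, P x -> P y -> P (k *: x + y)) ->
  (forall w, P (tmon w)) -> forall x, P x.
Proof.
move=> P0 Pl Pm x; elim/tcls_ind: x => x; rewrite tcls_sum.
elim: x => [|c x IHx]; first by rewrite big_nil.
by rewrite big_cons; exact: Pl.
Qed.

Lemma tcons_linearl x : linear (tcons^~ x).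
Proof.
move=> k a b; elim/tensor_span: x => [|l x y IHx IHy|w].
- by rewrite !tcons_rules; lin_ring.
- by rewrite !tcons_rules IHx IHy; lin_ring.
- by rewrite !tcons_mon; exact: (tmon_multilinear [::]).
Qed.

Lemma tconsDl a b x : tcons (a + b) x = tcons a x + tcons b x.
Proof. by have [[E _] _] := linear_rulesP (tcons_linearl x); exact: E. Qed.

Lemma tconsZl k a x : tcons (k *: a) x = k *: tcons a x.
Proof. by have [_ [E _]] := linear_rulesP (tcons_linearl x); exact: E. Qed.

Lemma tcons0l x : tcons 0 x = 0.
Proof. by have [_ [_ E]] := linear_rulesP (tcons_linearl x); exact: E. Qed.

End Words.

Arguments tone {R A}.

(** * Homogeneous elements *)

Section Homogeneous.
Variables (R : comPzRingType) (A : lmodType R) (hom : int -> A -> Prop).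
Hypothesis homP : is_grading hom.
Local Notation T := (tensor A).
Local Notation thom := (thom hom).

Lemma thom_linear p k x y : thom p x -> thom p y -> thom p (k *: x + y).
Proof.
case=> s hs -> [t ht ->]; exists ([seq (k * c.1, c.2) | c <- s] ++ t).
  by move=> c; rewrite mem_cat => /orP[/mapP[c' /hs hc' ->]|/ht].
rewrite big_cat big_map scaler_sumr; congr (_ + _).
by apply: eq_bigr => c _; rewrite scalerA.
Qed.

Lemma thom0 p : thom p 0.
Proof. by exists [::]; rewrite ?big_nil. Qed.

Lemma thomD p x y : thom p x -> thom p y -> thom p (x + y).
Proof. by rewrite -{2}[x]scale1r; exact: thom_linear. Qed.

Lemma thomZ p k x : thom p x -> thom p (k *: x).
Proof. by move=> hx; rewrite -[_ *: _]addr0; apply: thom_linear (thom0 p). Qed.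

Lemma thomN p x : thom p x -> thom p (- x).
Proof. by rewrite -scaleN1r; exact: thomZ. Qed.

Lemma thom_mon h : homogeneous hom h -> thom (wdeg h) (ttmon h).
Proof.
move=> hh; exists [:: (1, h)]; last by rewrite big_seq1 scale1r.
by move=> c; rewrite inE => /eqP->.
Qed.

Lemma homogeneous_cons q a h :
  homogeneous hom ((q, a) :: h) <-> hom q a /\ homogeneous hom h.
Proof.
split=> [hh|[ha hh] c]; last by rewrite inE => /predU1P[->|/hh].
split; first by apply: (hh (q, a)); exact: mem_head.
by move=> c hc; apply: hh; rewrite inE hc orbT.
Qed.

Lemma wdeg_cons q a (h : seq (int * A)) : wdeg ((q, a) :: h) = q + 1 + wdeg h.
Proof. exact: big_cons. Qed.

Lemma ttmon_cons q a (h : seq (int * A)) :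
  ttmon ((q, a) :: h) = tcons a (ttmon h).
Proof. by rewrite /ttmon tcons_mon. Qed.

Lemma thom_one : thom 0 tone.
Proof. by have := @thom_mon [::]; rewrite /wdeg big_nil; apply. Qed.

Lemma thom_words (P : T -> Prop) p :
  P 0 ->
  (forall k x y, thom p x -> thom p y -> P x -> P y -> P (k *: x + y)) ->
  (forall h, homogeneous hom h -> wdeg h = p -> P (ttmon h)) ->
  forall x, thom p x -> P x.
Proof.
move=> P0 Pl Pm _ [s hs ->].
suff [//] : thom p (\sum_(c <- s) c.1 *: ttmon c.2) /\
            P (\sum_(c <- s) c.1 *: ttmon c.2).
elim: s hs => [|c s IHs] hs.
  by rewrite big_nil; split; first exact: thom0.
have [hc Ec] := hs c (mem_head _ _).
have [|hs' Ps] := IHs; first by move=> c' c's; apply: hs; rewrite inE c's orbT.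
rewrite big_cons.
split; first by apply: thom_linear => //; rewrite -Ec; exact: thom_mon.
by apply: Pl => //; [rewrite -Ec; exact: thom_mon | exact: Pm].
Qed.

Lemma thom_cons q a p x : hom q a -> thom p x -> thom (q + 1 + p) (tcons a x).
Proof.
move=> ha; elim/thom_words => {x}[|k x y _ _ IHx IHy|h hh <-].
- by rewrite tcons_rules; exact: thom0.
- by rewrite !tcons_rules; exact: thom_linear.
- rewrite -(ttmon_cons q) -(wdeg_cons _ a); apply: thom_mon.
  exact/homogeneous_cons.
Qed.

(** A recursion step turns a word into a shuffle or a differential of words, so
    identities are proved for homogeneous elements rather than for words; the
    degree stays in the predicate because the signs depend on it. *)
Lemma thom_ind (P : int -> T -> Prop) :
  (forall p, P p 0) ->
  (forall p k x y, thom p x -> thom p y -> P p x -> P p y ->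
     P p (k *: x + y)) ->
  P 0 tone ->
  (forall q a p x, hom q a -> thom p x -> P p x -> P (q + 1 + p) (tcons a x)) ->
  forall p x, thom p x -> P p x.
Proof.
move=> P0 Pl P1 Pc p; apply: thom_words => [||h hh <-].
- exact: P0.
- exact: Pl.
elim: h hh => [|[q a] h IHh]; first by rewrite /wdeg big_nil.
case/homogeneous_cons=> ha hh; rewrite ttmon_cons wdeg_cons.
by apply: Pc => //; [exact: thom_mon | exact: IHh].
Qed.

Lemma expand_hom w h : h \in expand homP w -> homogeneous hom h.
Proof.
elim: w h => [|a w IHw] h /=; first by rewrite inE => /eqP->.
case/allpairsP=> -[c h'] /= [/mapP[p _ ->] /IHw hh' ->].
by apply/homogeneous_cons; split=> //; have [] := compP homP a.
Qed.

Lemma tmon_expand w : tmon w = \sum_(h <- expand homP w) ttmon h.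
Proof.
elim: w => [|a w IHw] /=; first by rewrite big_seq1.
rewrite big_allpairs_dep big_map.
under eq_bigr => p _ do under eq_bigr => h _ do rewrite ttmon_cons.
have [_ _ _ {1}->] := compP homP a.
rewrite -tcons_mon IHw.
elim: (supp _ _) => [|p s IHs]; first by rewrite !big_nil tcons0l.
rewrite !big_cons tconsDl IHs; congr (_ + _).
elim: (expand _ _) => [|h r IHr]; first by rewrite !big_nil !tcons_rules.
by rewrite !big_cons tcons_rules IHr.
Qed.

Lemma thom_span (P : T -> Prop) :
  P 0 -> (forall k x y, P x -> P y -> P (k *: x + y)) ->
  (forall p x, thom p x -> P x) -> forall x, P x.
Proof.
move=> P0 Pl Ph; elim/tensor_span => // w; rewrite tmon_expand big_seq.
apply: (big_ind P) => // [x y Px Py|h /expand_hom hh].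
  by rewrite -[x]scale1r; exact: Pl.
exact: Ph (thom_mon hh).
Qed.

(** The projection onto the part of degree p.  It is well defined because the
    degree of a homogeneous word depends on the tags of its letters only, and it
    separates the degrees. *)
Definition tproj (p : int) : T -> T :=
  hlift homP (fun h => if wdeg h == p then ttmon h else 0).

Let tproj_multilinear p :
  hmultilinear (fun h : seq (int * A) => if wdeg h == p then ttmon h else 0).
Proof.
move=> u q k a b v.
have E x : wdeg (u ++ (q, x) :: v) = wdeg (u ++ (q, a) :: v).
  by rewrite /wdeg !big_cat !big_cons.
rewrite !(E b) !(E (_ + _)); case: ifP => _; last by rewrite scaler0 addr0.
by rewrite /ttmon /unzip2 !map_cat tmon_multilinear.
Qed.

Lemma tproj_linear p : linear (tproj p).
Proof. exact: hlift_linear. Qed.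

Definition tproj_rules p := linear_rulesP (tproj_linear p).

Lemma tproj_hom p q x : thom q x -> tproj p x = if q == p then x else 0.
Proof.
elim/thom_words => {x}[|k x y _ _ IHx IHy|h hh <-].
- by rewrite tproj_rules if_same.
- by rewrite !tproj_rules IHx IHy; case: ifP; rewrite // scaler0 addr0.
- by rewrite /tproj hlift_mon.
Qed.

Lemma thom_grading : is_grading thom.
Proof.
split=> [||x|s c us hc sum0 p ps]; [exact: thom0 | exact: thom_linear | |].
- have [D [r [uD hr ->]]] : exists (D : seq int) (r : seq (R * seq (int * A))),
      [/\ uniq D, forall c, c \in r -> homogeneous hom c.2 /\ wdeg c.2 \in D
        & x = \sum_(c <- r) c.1 *: ttmon c.2].
    elim/thom_span: x => [|k x y [D [r [uD hr ->]]] [D' [r' [uD' hr' ->]]]|p x].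
    + by exists [::], [::]; rewrite big_nil.
    + exists (undup (D ++ D')), ([seq (k * c.1, c.2) | c <- r] ++ r').
      split; first exact: undup_uniq.
        move=> c; rewrite mem_cat mem_undup mem_cat => /orP[/mapP[c' + ->]|].
          by move=> /hr[? ->].
        by move=> /hr'[? ->]; rewrite orbT.
      rewrite big_cat big_map scaler_sumr; congr (_ + _).
      by apply: eq_bigr => c _; rewrite scalerA.
    + case=> r hr ->; exists [:: p], r; split=> // c /hr[? ->].
      by rewrite mem_head.
  exists D, (fun p => \sum_(c <- r | wdeg c.2 == p) c.1 *: ttmon c.2).
  split=> //.
    move=> p; rewrite big_seq_cond; apply: (big_ind (thom p)) => [||c].
    - exact: thom0.
    - exact: thomD.
    - by case/andP=> /hr[hc _] /eqP <-; apply: thomZ; exact: thom_mon.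
  rewrite (exchange_big_dep predT) //=; apply: eq_big_seq => c /hr[_ cD].
  under eq_bigl => p do rewrite eq_sym.
  by rewrite -big_filter filter_pred1_uniq // big_seq1.
- have /(congr1 (tproj p)) := sum0; rewrite tproj_rules.
  have -> : tproj p (\sum_(q <- s) c q) = \sum_(q <- s) tproj p (c q).
    by apply: (big_morph (tproj p)) => [x y|]; rewrite tproj_rules.
  rewrite (bigD1_seq p) //= (tproj_hom _ (hc p)) eqxx big1 ?addr0 // => q.
  by move=> /negPf qp; rewrite (tproj_hom _ (hc q)) qp.
Qed.

End Homogeneous.

(** * Shuffles, sorted by the letter that comes first *)

(** Deleting i and its image j is a bijection from the permutations that send i
    to j to the permutations of one letter less. *)
Lemma lift_perm_reindex (V : nmodType) N (i j : 'I_N.+1) (P : pred 'S_N.+1)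
    (F : 'S_N.+1 -> V) :
  \sum_(s | P s && (s i == j)) F s =
  \sum_(s | P (lift_perm i j s)) F (lift_perm i j s).
Proof.
rewrite (reindex (lift_perm i j)) /=.
  by apply: eq_bigl => s; rewrite lift_perm_id eqxx andbT.
pose g (s : 'S_N.+1) (k : 'I_N) : 'I_N := odflt k (unlift (s i) (s (lift i k))).
have gK (s : 'S_N.+1) k : lift (s i) (g s k) = s (lift i k).
  rewrite /g; have := neq_lift i k; rewrite -(can_eq (permK s)).
  by case/unlift_some => k' -> ->.
have g_inj (s : 'S_N.+1) : injective (g s).
  by move=> k l /(congr1 (lift (s i))); rewrite !gK => /perm_inj/lift_inj.
exists (fun s => perm (@g_inj s)) => [s _|s /andP[_ /eqP sij]].
  apply/permP => k; apply: (@lift_inj _ j).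
  by rewrite permE -{1}(lift_perm_id i j s) gK lift_perm_lift.
apply/permP => k; case: (unliftP i k) => [l ->|->]; last first.
  by rewrite lift_perm_id.
by rewrite lift_perm_lift permE -sij gK.
Qed.

(** The condition defining a shuffle, with the total number N of letters kept
    apart from the lengths n and N - n of the two words: deleting a letter of
    either word then lowers N by one without any cast between 'S_(n + m.+1) and
    'S_(n.+1 + m). *)
Definition increasing_runs N (n : nat) (s : 'S_N) : bool :=
  [forall i : 'I_N, forall j : 'I_N,
    (i < j)%N && ((j < n)%N || (n <= i)%N) ==> (s i < s j)%N].

Lemma increasing_runsP N n (s : 'S_N) :
  reflect (forall i j : 'I_N, (i < j)%N -> (j < n)%N || (n <= i)%N ->
             (s i < s j)%N) (increasing_runs n s).
Proof.
apply: (iffP forallP) => [H i j ij nij|H i].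
  by have /forallP/(_ j) := H i; rewrite ij nij.
by apply/forallP => j; apply/implyP => /andP[]; exact: H.
Qed.

(** The letter that comes first after shuffling was the first of its word. *)
Lemma increasing_runs_first N n (s : 'S_N.+1) i :
  increasing_runs n s -> s i = ord0 -> i = ord0 \/ i = n :> nat.
Proof.
move=> /increasing_runsP H si.
have [i0|i0] := posnP i; first by left; apply: val_inj.
have [i_lt|i_gt|] := ltngtP i n; last by right.
  by have := H ord0 i i0; rewrite i_lt si ltn0 => /(_ isT).
have nN : (n < N.+1)%N by exact: ltn_trans i_gt (ltn_ord i).
by have := H (Ordinal nN) i i_gt; rewrite leqnn orbT si ltn0 => /(_ isT).
Qed.

Lemma increasing_runs_lift N n (i : 'I_N.+1) (s : 'S_N) :
  i = ord0 \/ i = n :> nat ->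
  increasing_runs n (lift_perm i ord0 s) = increasing_runs (n - (i < n)) s.
Proof.
move=> i0n; apply/increasing_runsP/increasing_runsP => H k l.
  move=> kl nkl; have := H (lift i k) (lift i l).
  rewrite !lift_perm_lift /= /bump !leq0n !add1n ltnS; apply; lia.
case: (unliftP i k) => [k' ->|->]; case: (unliftP i l) => [l' ->|->].
- rewrite !lift_perm_lift /= => kl nkl; rewrite /bump !leq0n !add1n ltnS.
  by apply: H; move: kl nkl; rewrite /bump; lia.
- (* No letter of the same word precedes i. *)
  by case: i0n => [->|]; rewrite /= /bump; lia.
- by rewrite lift_perm_id lift_perm_lift.
- by rewrite ltnn.
Qed.

(** The letter i that comes first is inverted with exactly the letters before
    it. *)
Lemma koszul_lift N (deg : nat -> int) (i : 'I_N.+1) (s : 'S_N) :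
  koszul deg (lift_perm i ord0 s) =
  (deg i + 1) * (\sum_(0 <= j < i) (deg j + 1)) + koszul (deg \o bump i) s.
Proof.
rewrite /koszul (bigD1_ord i) //= [X in X + _]big1 ?add0r; last first.
  by move=> j; rewrite lift_perm_id ltn0 andbF.
have E k : \sum_(j < N.+1 | (lift i k < j)%N &&
        (lift_perm i ord0 s j < lift_perm i ord0 s (lift i k))%N)
      (deg (lift i k) + 1) * (deg j + 1) =
    (if (k < i)%N then (deg k + 1) * (deg i + 1) else 0) +
    \sum_(l < N | (k < l)%N && (s l < s k)%N)
      (deg (bump i k) + 1) * (deg (bump i l) + 1).
  rewrite big_mkcond (bigD1_ord i) //= [in RHS]big_mkcond /=.
  congr (_ + _).
    rewrite lift_perm_id lift_perm_lift lift0 ltn0Sn andbT.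
    have [ki|ik] := ltnP k i.
      by rewrite /bump (leqNgt i k) ki /= add0n ki.
    by rewrite /bump ik add1n ltnNge leqW.
  apply: eq_bigr => l _; rewrite !lift_perm_lift !lift0 ltnS.
  by rewrite [(bump i k < _)%N]ltnNge leq_bump2 -ltnNge.
rewrite (eq_bigr _ (fun k _ => E k)) big_split /=; congr (_ + _).
rewrite -big_mkcond big_mkord.
rewrite (big_ord_widen N (fun j => deg j + 1)); last by rewrite -ltnS.
by rewrite mulr_sumr; apply: eq_bigr => j _; rewrite mulrC.
Qed.

Section ShuffleTerms.
Variables (R : comPzRingType) (A : lmodType R).
Local Notation T := (tensor A).
Implicit Types (W : seq (int * A)) (c : int * A).

Definition shuffle_term N W (s : 'S_N) : T :=
  sgn R (koszul (nth 0 (unzip1 W)) s) *: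
  tmon [seq nth 0 (unzip2 W) ((s^-1)%g i) | i <- enum 'I_N].

Lemma nth_bump (B : Type) (x0 : B) (s1 s2 : seq B) y k :
  nth x0 (s1 ++ y :: s2) (bump (size s1) k) = nth x0 (s1 ++ s2) k.
Proof.
rewrite !nth_cat /bump; have [h|h] /= := leqP (size s1) k; last first.
  by rewrite add0n h.
by rewrite add1n ltnNge leqW //= subSn.
Qed.

Lemma shuffle_term_lift N (i : 'I_N.+1) (s : 'S_N) W1 c W2 :
  i = size W1 :> nat -> (size W1 + size W2)%N = N ->
  shuffle_term (W1 ++ c :: W2) (lift_perm i ord0 s) =
  sgn R ((c.1 + 1) * wdeg W1) *: tcons c.2 (shuffle_term (W1 ++ W2) s).
Proof.
move=> iW1 eN; rewrite /shuffle_term tcons_rules tcons_mon scalerA koszul_lift.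
rewrite -sgnD.
congr (sgn R (_ * _ + _) *: tmon _).
- by rewrite /unzip1 map_cat /= iW1 -(size_map fst) nth_slot.
- rewrite /unzip1 map_cat /= iW1 -(size_map fst W1) big_nat.
  rewrite (eq_bigr (fun j => nth 0 (unzip1 W1) j + 1)); last first.
    by move=> j /andP[_ jW]; rewrite nth_cat jW.
  have -> : wdeg W1 = \sum_(q <- unzip1 W1) (q + 1) by rewrite big_map.
  by rewrite -big_nat [RHS](big_nth 0).
- apply: eq_bigr => k _; apply: eq_bigr => l _.
  by rewrite /= iW1 /unzip1 !map_cat /= -(size_map fst W1) !nth_bump.
- rewrite enum_ordSl /= -map_comp; congr (_ :: _).
    rewrite lift_permV lift_perm_id iW1 /unzip2 map_cat /=.
    by rewrite -(size_map snd W1) nth_slot.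
  apply: eq_map => k /=; rewrite lift_permV lift_perm_lift /= iW1.
  by rewrite /unzip2 !map_cat /= -(size_map snd W1) nth_bump.
Qed.

(** The shuffle product of the first n letters of W with the others. *)
Definition shuffle_sum N n W : T :=
  \sum_(s : 'S_N | increasing_runs n s) shuffle_term W s.

Lemma shuffle_sum_at N n (i : 'I_N.+1) W1 c W2 :
  i = size W1 :> nat -> (size W1 + size W2)%N = N -> i = ord0 \/ i = n :> nat ->
  \sum_(s : 'S_N.+1 | increasing_runs n s && (s i == ord0))
     shuffle_term (W1 ++ c :: W2) s =
  sgn R ((c.1 + 1) * wdeg W1) *:
    tcons c.2 (shuffle_sum N (n - (i < n)) (W1 ++ W2)).
Proof.
move=> iW1 eN i0n; rewrite lift_perm_reindex.
rewrite (eq_bigl _ _ (fun s => increasing_runs_lift s i0n)).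
under eq_bigr => s _ do rewrite (@shuffle_term_lift _ i) //.
rewrite /shuffle_sum -scaler_sumr; congr (_ *: _).
by apply/esym/(big_morph (tcons c.2)) => [x y|]; rewrite tcons_rules.
Qed.

Lemma shuffle_sum_split N n W :
  shuffle_sum N.+1 n W =
  \sum_(i : 'I_N.+1 | (i == ord0) || (i == n :> nat))
    \sum_(s : 'S_N.+1 | increasing_runs n s && (s i == ord0)) shuffle_term W s.
Proof.
rewrite /shuffle_sum (partition_big (fun s : 'S_N.+1 => (s^-1)%g ord0)
  (fun i => (i == ord0) || (i == n :> nat))) /=; last first.
  move=> s hs; have := increasing_runs_first hs (permKV s ord0).
  by case=> [->|->]; rewrite eqxx ?orbT.
apply: eq_bigr => i _; apply: eq_bigl => s; congr (_ && _).
by apply/eqP/eqP => [<-|<-]; rewrite ?permK ?permKV.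
Qed.

Lemma shuffle_sum_nil n : shuffle_sum 0 n [::] = tone.
Proof.
rewrite /shuffle_sum (big_pred1 (1%g : 'S_0)) => [|s]; last first.
  have -> : s = (1%g : 'S_0) by apply/permP => -[].
  by rewrite /= eqxx; apply/increasing_runsP => -[].
rewrite /shuffle_term /koszul big_ord0 /sgn expr0 scale1r.
by have -> : enum 'I_0 = [::] by apply: size0nil; rewrite size_enum_ord.
Qed.

(** One of the two words is empty: there is only one letter to start with, and
    the sum has a single term, the word itself. *)
Lemma shuffle_sum_cons N n c W : n = 0%N \/ n = N.+1 -> size W = N ->
  shuffle_sum N.+1 n (c :: W) = tcons c.2 (shuffle_sum N n.-1 W).
Proof.
move=> n0N eN; rewrite shuffle_sum_split.
rewrite (big_pred1 ord0) => [|i] /=; last first.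
  rewrite -!val_eqE /=; case: n0N => ->; first by rewrite orbb.
  by rewrite [_ == N.+1]ltn_eqF ?orbF.
rewrite (@shuffle_sum_at _ _ ord0 [::]) //=; last by left.
rewrite /wdeg big_nil mulr0 /sgn expr0 scale1r; congr tcons; congr shuffle_sum.
by case: n {n0N} => // n; rewrite subn1.
Qed.

(** The first letter is c or c'; in the second case c' has moved past the whole
    first word. *)
Lemma shuffle_sum_cons2 N n c W1 c' W2 :
  size W1 = n -> (size W1 + size W2)%N = N ->
  shuffle_sum N.+2 n.+1 (c :: W1 ++ c' :: W2) =
  tcons c.2 (shuffle_sum N.+1 n (W1 ++ c' :: W2)) +
  sgn R ((c'.1 + 1) * wdeg (c :: W1)) *:
    tcons c'.2 (shuffle_sum N.+1 n.+1 (c :: W1 ++ W2)).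
Proof.
move=> en eN; have nN : (n.+1 < N.+2)%N by rewrite -eN -en !ltnS leq_addr.
rewrite shuffle_sum_split (bigD1 ord0) //=.
rewrite (big_pred1 (Ordinal nN)) => [|i]; last first.
  rewrite -!val_eqE /= andb_orl andbN /=.
  by apply/andP/eqP => [[/eqP ein _]|->] //; exact: val_inj.
congr (_ + _).
  rewrite (@shuffle_sum_at _ _ ord0 [::]) //=; last by left.
    rewrite /wdeg big_nil mulr0 /sgn expr0 scale1r subn1 //.
  by rewrite size_cat /= addnS eN.
rewrite (@shuffle_sum_at _ _ (Ordinal nN) (c :: W1)) //=.
- by rewrite ltnn subn0.
- by rewrite en.
- by rewrite addSn eN.
- by right.
Qed.

End ShuffleTerms.

(** * Recursion on the first letter *)

Section Recursion.
Variables (R : comPzRingType) (A : dgAlgebra R).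
Local Notation T := (tensor A).
Local Notation hom := (@dga_hom R A).
Local Notation thom := (@TA_hom R A).
Local Notation "a ## x" := (tcons a x) (at level 38, right associativity).
Local Notation "x ** y" := (@TA_shuffle R A x y)
  (at level 39, left associativity).
Local Notation mu := (@dga_mu R A).
Local Notation dA := (@dga_d R A).
Local Notation d := (@TA_d R A).
Local Notation Delta := (@TA_Delta R A).

Let dgaA := dga_axioms A.
Let homP := dga_grading dgaA.

Definition TA_d_rules := linear_rulesP (@TA_d_linear R A).
Definition TA_Delta_rules := linear_rulesP (@TA_Delta_linear R A).
Definition TA_shuffle_rulesr x := linear_rulesP (@TA_shuffle_linearr R A x).

Lemma TA_shuffleDl x x' y : (x + x') ** y = x ** y + x' ** y.
Proof.
by have [[E _] _] := linear_rulesP (@TA_shuffle_linearl R A y); exact: E.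
Qed.

Lemma TA_shuffleZl k x y : (k *: x) ** y = k *: x ** y.
Proof.
by have [_ [E _]] := linear_rulesP (@TA_shuffle_linearl R A y); exact: E.
Qed.

Lemma TA_shuffleNl x y : (- x) ** y = - (x ** y).
Proof.
by have [[_ E] _] := linear_rulesP (@TA_shuffle_linearl R A y); exact: E.
Qed.

Lemma TA_shuffle0l y : 0 ** y = 0.
Proof.
by have [_ [_ E]] := linear_rulesP (@TA_shuffle_linearl R A y); exact: E.
Qed.

(** The operator M_a: the part of Delta (a.x) in which a itself is merged, up to
    sign. *)
Definition tmerge (a : A) : T -> T :=
  tlift (fun w => if w is b :: w' then tmon (mu a b :: w') else 0).

Let tmerge_multilinear a :
  multilinear (fun w => if w is b :: w' then tmon (mu a b :: w') else 0 : T).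
Proof.
move=> [|b u] k a1 a2 v /=; last exact: (tmon_multilinear (mu a b :: u)).
by rewrite (dga_mu_linearr dgaA); exact: (tmon_multilinear [::]).
Qed.

Lemma tmerge_linear a : linear (tmerge a).
Proof. exact: tlift_linear. Qed.

Definition tmerge_rules a := linear_rulesP (tmerge_linear a).

Definition TA_rules := (tcons_rules, tmerge_rules, TA_d_rules, TA_Delta_rules,
  TA_shuffle_rulesr, (TA_shuffleDl, TA_shuffleZl, TA_shuffleNl, TA_shuffle0l),
  (tconsDl, tconsZl, tcons0l)).

Lemma tmerge_one a : tmerge a tone = 0.
Proof. exact: tlift_mon. Qed.

Lemma tmerge_cons a b x : tmerge a (b ## x) = mu a b ## x.
Proof.
elim/tensor_span: x => [|k x y IHx IHy|w]; first by rewrite !TA_rules.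
  by rewrite !TA_rules IHx IHy.
by rewrite !tcons_mon /tmerge tlift_mon.
Qed.

Lemma tcons_sum (I : Type) (r : seq I) a (F : I -> T) :
  a ## (\sum_(i <- r) F i) = \sum_(i <- r) a ## F i.
Proof. by apply: (big_morph (tcons a)) => [x y|]; rewrite TA_rules. Qed.

(** Induction along the words themselves, to read the recursions off the
    formulas for d, Delta and the shuffle product. *)
Lemma homogeneous_ind (P : T -> Prop) :
  P 0 -> (forall k x y, P x -> P y -> P (k *: x + y)) ->
  (forall h, homogeneous hom h -> P (ttmon h)) -> forall x, P x.
Proof.
move=> P0 Pl Ph; apply: (thom_span homP) => // p x.
apply: thom_words => [|k x' y _ _|h hh _]; [exact: P0 | exact: Pl |].
exact: Ph.
Qed.

Lemma TA_d_one : d tone = 0.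
Proof. by rewrite -[tone]/(ttmon [::]) TA_d_mon // /dw big_ord0. Qed.

Lemma TA_d_cons q a x : hom q a ->
  d (a ## x) = dA a ## x + sgn R (q + 1) *: a ## d x.
Proof.
move=> ha; elim/homogeneous_ind: x => [|k x y IHx IHy|h hh].
- by rewrite !TA_rules; lin_signs.
- by rewrite !TA_rules IHx IHy; lin_ring.
rewrite -(ttmon_cons q) !TA_d_mon //; last exact/homogeneous_cons.
rewrite /dw /= big_ord_recl /= /wdeg big_nil sgn0 scale1r.
rewrite drop0 tcons_mon; congr (_ + _).
rewrite tcons_sum scaler_sumr; apply: eq_bigr => i _.
by rewrite /= big_cons !sgnD !TA_rules tcons_mon scalerA.
Qed.

Lemma TA_Delta_one : Delta tone = 0.
Proof. by rewrite -[tone]/(ttmon [::]) TA_Delta_mon // /Deltaw big_ord0. Qed.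

Lemma TA_Delta_cons q a x : hom q a ->
  Delta (a ## x) = sgn R q *: (tmerge a x - a ## Delta x).
Proof.
move=> ha; elim/homogeneous_ind: x => [|k x y IHx IHy|h hh].
- by rewrite !TA_rules; lin_signs.
- by rewrite !TA_rules IHx IHy; lin_ring.
rewrite -(ttmon_cons q) !TA_Delta_mon //; last exact/homogeneous_cons.
case: h hh => [|[r b] h] hh.
  by rewrite /Deltaw /= !big_ord0 tmerge_one TA_rules subr0 scaler0.
rewrite /Deltaw /= big_ord_recl /= ttmon_cons tmerge_cons tcons_mon.
rewrite /wdeg big_cons big_nil addr0 addrK drop0 scalerBr; congr (_ + _).
rewrite tcons_sum scaler_sumr -sumrN; apply: eq_bigr => i _.
rewrite /= big_cons TA_rules tcons_mon add0n /bump /= add1n.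
by move: (\sum_(c <- _) _) => n; lin_signs.
Qed.

Lemma shufwE (u v : seq (int * A)) :
  shufw u v = shuffle_sum (size u + size v) (size u) (u ++ v).
Proof. by []. Qed.

Lemma shufw_nill v : shufw [::] v = ttmon v :> T.
Proof.
rewrite shufwE /=; elim: v => [|c v IHv]; first exact: shuffle_sum_nil.
rewrite /= shuffle_sum_cons //; last by left.
by case: c => q a; rewrite ttmon_cons -IHv.
Qed.

Lemma shufw_nilr u : shufw u [::] = ttmon u :> T.
Proof.
rewrite shufwE addn0 cats0; elim: u => [|c u IHu]; first exact: shuffle_sum_nil.
rewrite /= shuffle_sum_cons //; last by right.
by case: c => q a; rewrite ttmon_cons -IHu.
Qed.

Lemma shufw_cons c u c' v :
  shufw (c :: u) (c' :: v) =
  c.2 ## shufw u (c' :: v) +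
  sgn R ((c'.1 + 1) * wdeg (c :: u)) *: c'.2 ## shufw (c :: u) v :> T.
Proof.
rewrite !shufwE /= addSn addnS (@shuffle_sum_cons2 _ _ _ (size u)) //.
Qed.

Lemma TA_shuffle1 y : tone ** y = y.
Proof.
elim/homogeneous_ind: y => [|k x y IHx IHy|h hh]; first by rewrite !TA_rules.
  by rewrite !TA_rules IHx IHy.
by rewrite -{1}[tone]/(ttmon [::]) TA_shuffle_mon ?shufw_nill.
Qed.

Lemma TA_shuffler1 x : x ** tone = x.
Proof.
elim/homogeneous_ind: x => [|k x y IHx IHy|h hh]; first by rewrite !TA_rules.
  by rewrite !TA_rules IHx IHy.
by rewrite -{1}[tone]/(ttmon [::]) TA_shuffle_mon ?shufw_nilr.
Qed.

(** The sign is that of moving b past a and x, whence the degree of x. *)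
Lemma TA_shuffle_cons q a r b p x y : hom q a -> hom r b -> thom p x ->
  a ## x ** b ## y =
  a ## (x ** b ## y) + sgn R ((r + 1) * (q + 1 + p)) *: b ## (a ## x ** y).
Proof.
move=> ha hb; elim/thom_words => {x} [|k x x' _ _ IHx IHx'|u hu <-].
- by rewrite !TA_rules; lin_signs.
- by rewrite !TA_rules IHx IHx'; lin_ring.
elim/homogeneous_ind: y => [|k y y' IHy IHy'|v hv].
- by rewrite !TA_rules; lin_signs.
- by rewrite !TA_rules IHy IHy'; lin_ring.
rewrite -(ttmon_cons q) -(ttmon_cons r).
rewrite !TA_shuffle_mon //; try exact/homogeneous_cons.
by rewrite shufw_cons /= wdeg_cons.
Qed.

Lemma TA_ind (P : T -> Prop) :
  P 0 -> (forall k x y, P x -> P y -> P (k *: x + y)) -> P tone ->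
  (forall q a x, hom q a -> P x -> P (a ## x)) -> forall x, P x.
Proof.
move=> P0 Pl P1 Pc; apply: (thom_span homP) => // p x hx.
refine (@thom_ind _ _ hom (fun _ => P) _ _ P1 _ p x hx) => //.
  by move=> q k y z _ _; exact: Pl.
by move=> q a r y ha _; exact: Pc ha.
Qed.

Lemma thom_d p x : thom p x -> thom (p + 1) (d x).
Proof.
move: p x; apply: thom_ind => [p|p k x y _ _||q a p x ha hx IHx].
- by rewrite TA_rules; exact: thom0.
- by rewrite !TA_rules; exact: thom_linear.
- by rewrite TA_d_one; exact: thom0.
rewrite (TA_d_cons _ ha); apply: thomD.
  by rewrite addrAC; apply: thom_cons => //; exact: dga_d_deg dgaA _ _ ha.
by apply: thomZ; rewrite -addrA; exact: thom_cons.
Qed.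

Lemma thom_merge q a p x : hom q a -> thom p x -> thom (q + p) (tmerge a x).
Proof.
move=> ha; move: p x; apply: thom_ind => [p|p k x y _ _||r b p x hb hx _].
- by rewrite TA_rules; exact: thom0.
- by rewrite !TA_rules; exact: thom_linear.
- by rewrite tmerge_one; exact: thom0.
rewrite tmerge_cons !addrA; apply: thom_cons => //.
exact: dga_mu_deg dgaA _ _ _ _ ha hb.
Qed.

Lemma thom_Delta p x : thom p x -> thom (p - 1) (Delta x).
Proof.
move: p x; apply: thom_ind => [p|p k x y _ _||q a p x ha hx IHx].
- by rewrite TA_rules; exact: thom0.
- by rewrite !TA_rules; exact: thom_linear.
- by rewrite TA_Delta_one; exact: thom0.
rewrite (TA_Delta_cons _ ha); apply: thomZ; apply: thomD.
  have -> : q + 1 + p - 1 = q + p by ring.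
  exact: thom_merge.
by apply: thomN; rewrite -addrA; exact: thom_cons.
Qed.

Lemma thom_shuffle p q x y : thom p x -> thom q y -> thom (p + q) (x ** y).
Proof.
move=> hx; move: p x hx q y.
apply: thom_ind => [p|p k x x' _ _ IHx IHx'||q a p x ha hx IHx] r y hy.
- by rewrite TA_rules; exact: thom0.
- by rewrite !TA_rules; apply: thom_linear; [exact: IHx | exact: IHx'].
- by rewrite TA_shuffle1 add0r.
move: r y hy; apply: thom_ind => [r|r k y y' _ _ IHy IHy'||r b p' y hb hy IHy].
- by rewrite TA_rules; exact: thom0.
- by rewrite !TA_rules; exact: thom_linear.
- by rewrite TA_shuffler1 addr0; exact: thom_cons.
rewrite (TA_shuffle_cons _ ha hb hx); apply: thomD.
  rewrite -(addrA (q + 1)); apply: thom_cons => //.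
  by apply: IHx; exact: thom_cons.
apply: thomZ.
have -> : q + 1 + p + (r + 1 + p') = r + 1 + (q + 1 + p + p') by ring.
exact: thom_cons.
Qed.

(** * The two differentials *)

Lemma TA_dd x : d (d x) = 0.
Proof.
elim/TA_ind: x => [|k x y IHx IHy||q a x ha IHx].
- by rewrite !TA_rules.
- by rewrite !TA_rules IHx IHy; lin_ring.
- by rewrite TA_d_one TA_rules.
rewrite (TA_d_cons _ ha) !TA_rules (TA_d_cons _ ha).
rewrite (TA_d_cons _ (dga_d_deg dgaA ha)) (dga_dd dgaA) IHx !TA_rules.
by lin_signs.
Qed.

(** The derivation property of d_A, applied to a and the first letter of x. *)
Lemma TA_d_merge q a x : hom q a ->
  d (tmerge a x) = tmerge (dA a) x + sgn R q *: tmerge a (d x).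
Proof.
move=> ha; elim/TA_ind: x => [|k x y IHx IHy||r b x hb _].
- by rewrite !TA_rules; lin_signs.
- by rewrite !TA_rules IHx IHy; lin_ring.
- by rewrite TA_d_one !tmerge_one !TA_rules; lin_signs.
rewrite tmerge_cons (TA_d_cons _ (dga_mu_deg dgaA ha hb)) (TA_d_cons _ hb).
rewrite (dga_leibniz dgaA _ ha) !TA_rules !tmerge_cons.
by lin_signs.
Qed.

(** In d (Delta (a.x)) + Delta (d (a.x)) the terms with M_a and M_(da) cancel by
    [TA_d_merge], the others by induction. *)
Lemma TA_dDelta x : d (Delta x) + Delta (d x) = 0.
Proof.
suff: d (Delta x) = - Delta (d x) by move=> ->; rewrite addNr.
elim/TA_ind: x => [|k x y IHx IHy||q a x ha IHx].
- by rewrite !TA_rules; lin_signs.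
- by rewrite !TA_rules IHx IHy; lin_ring.
- by rewrite TA_Delta_one TA_d_one !TA_rules; lin_signs.
rewrite (TA_Delta_cons _ ha) (TA_d_cons _ ha) !TA_rules (TA_d_merge _ ha).
rewrite (TA_d_cons _ ha) (TA_Delta_cons _ ha).
rewrite (TA_Delta_cons _ (dga_d_deg dgaA ha)) IHx !TA_rules.
by lin_signs.
Qed.

(** The associativity of A, applied to a, b and the first letter of x. *)
Lemma tmerge_merge a b x : tmerge a (tmerge b x) = tmerge (mu a b) x.
Proof.
elim/TA_ind: x => [|k x y IHx IHy||r c x _ _].
- by rewrite !TA_rules.
- by rewrite !TA_rules IHx IHy.
- by rewrite !tmerge_one TA_rules.
by rewrite !tmerge_cons (dga_muA dgaA).
Qed.

Lemma TA_Delta_merge q a x : hom q a ->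
  Delta (tmerge a x) = sgn R q *: tmerge a (Delta x).
Proof.
move=> ha; elim/TA_ind: x => [|k x y IHx IHy||r b x hb _].
- by rewrite !TA_rules; lin_signs.
- by rewrite !TA_rules IHx IHy; lin_ring.
- by rewrite TA_Delta_one tmerge_one !TA_rules; lin_signs.
rewrite tmerge_cons (TA_Delta_cons _ (dga_mu_deg dgaA ha hb)).
rewrite (TA_Delta_cons _ hb).
rewrite !TA_rules !tmerge_cons tmerge_merge.
by lin_signs.
Qed.

(** Delta (Delta (a.x)) is, up to sign, Delta (M_a x) - Delta (a.(Delta x)); the
    two terms M_a (Delta x) that appear, one by [TA_Delta_merge], cancel. *)
Lemma TA_DeltaDelta x : Delta (Delta x) = 0.
Proof.
elim/TA_ind: x => [|k x y IHx IHy||q a x ha IHx].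
- by rewrite !TA_rules.
- by rewrite !TA_rules IHx IHy; lin_ring.
- by rewrite TA_Delta_one TA_rules.
rewrite (TA_Delta_cons _ ha) !TA_rules (TA_Delta_merge _ ha).
by rewrite (TA_Delta_cons _ ha) IHx !TA_rules; lin_signs.
Qed.

(** * The shuffle algebra *)

Lemma TA_shuffleC p q x y : thom p x -> thom q y ->
  x ** y = sgn R (p * q) *: y ** x.
Proof.
move=> hx; move: p x hx q y.
apply: thom_ind => [p|p k x x' _ _ IHx IHx'||q a p x ha hx IHx] r y hy.
- by rewrite !TA_rules scaler0.
- by rewrite !TA_rules (IHx _ _ hy) (IHx' _ _ hy); lin_ring.
- by rewrite TA_shuffle1 TA_shuffler1 mul0r sgn0 scale1r.
move: r y hy; apply: thom_ind => [r|r k y y' _ _ IHy IHy'||r b p' y hb hy IHy].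
- by rewrite !TA_rules scaler0.
- by rewrite !TA_rules IHy IHy'; lin_ring.
- by rewrite TA_shuffle1 TA_shuffler1 mulr0 sgn0 scale1r.
rewrite (TA_shuffle_cons _ ha hb hx) (TA_shuffle_cons _ hb ha hy).
rewrite (IHx _ _ (thom_cons hb hy)) IHy !TA_rules.
by lin_signs.
Qed.

(** Both sides of the identity for a.x, b.y and c.z are the sum of three terms,
    one for each letter that can come first, and these agree by induction. *)
Lemma TA_shuffleA x y z : x ** (y ** z) = x ** y ** z.
Proof.
elim/(thom_span homP): x => [|k x x' IHx IHx'|p x hx].
- by rewrite !TA_rules.
- by rewrite !TA_rules IHx IHx'.
elim/(thom_span homP): y => [|k y y' IHy IHy'|q y hy].
- by rewrite !TA_rules.
- by rewrite !TA_rules IHy IHy'.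
move: p x hx q y hy z.
apply: thom_ind => [p|p k x x' _ _ IHx IHx'||q a p x ha hx IHx] r y hy.
- by move=> z; rewrite !TA_rules.
- by move=> z; rewrite !TA_rules (IHx _ _ hy) (IHx' _ _ hy).
- by move=> z; rewrite !TA_shuffle1.
move: r y hy; apply: thom_ind => [r|r k y y' _ _ IHy IHy'||r b p' y hb hy IHy].
- by move=> z; rewrite !TA_rules.
- by move=> z; rewrite !TA_rules IHy IHy'.
- by move=> z; rewrite TA_shuffle1 TA_shuffler1.
elim/TA_ind => [|k z z' IHz IHz'||s c z hc IHz].
- by rewrite !TA_rules.
- by rewrite !TA_rules IHz IHz'.
- by rewrite !TA_shuffler1.
have hby := thom_cons hb hy; have hax := thom_cons ha hx.
rewrite (TA_shuffle_cons _ hb hc hy) (TA_shuffle_cons _ ha hb hx) !TA_rules.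
rewrite (TA_shuffle_cons _ ha hb hx) (TA_shuffle_cons _ ha hc hx).
rewrite (TA_shuffle_cons _ ha hc (thom_shuffle hx hby)).
rewrite (TA_shuffle_cons _ hb hc (thom_shuffle hax hy)).
rewrite IHy IHz -!(IHx _ _ hby) (TA_shuffle_cons _ hb hc hy).
rewrite (TA_shuffle_cons _ ha hb hx) !TA_rules.
by lin_signs.
Qed.

Lemma TA_leibniz p x y : thom p x ->
  d (x ** y) = d x ** y + sgn R p *: x ** d y.
Proof.
move=> hx; move: p x hx y.
apply: thom_ind => [p|p k x x' _ _ IHx IHx'||q a p x ha hx IHx] y.
- by rewrite !TA_rules; lin_signs.
- by rewrite !TA_rules IHx IHx'; lin_ring.
- by rewrite TA_d_one !TA_shuffle1 !TA_rules; lin_signs.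
elim/TA_ind: y => [|k y y' IHy IHy'||r b y hb IHy].
- by rewrite !TA_rules; lin_signs.
- by rewrite !TA_rules IHy IHy'; lin_ring.
- by rewrite TA_d_one !TA_shuffler1 !TA_rules; lin_signs.
rewrite (TA_shuffle_cons _ ha hb hx) !TA_rules (TA_d_cons _ ha).
rewrite !(TA_d_cons _ hb) (TA_d_cons _ ha).
rewrite IHx IHy (TA_d_cons _ ha) !(TA_d_cons _ hb) !TA_rules.
rewrite (TA_shuffle_cons _ (dga_d_deg dgaA ha) hb hx).
rewrite (TA_shuffle_cons _ ha hb (thom_d hx)).
rewrite (TA_shuffle_cons _ ha (dga_d_deg dgaA hb) hx).
rewrite (TA_shuffle_cons _ ha hb hx).
by lin_signs.
Qed.

(** * The bracket *)

(** The bracket is a difference; locking it keeps the rules that expand sums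
    from matching inside it. *)
Definition TA_bracket := locked (bracket Delta (@TA_shuffle R A)).

Local Notation B := TA_bracket.

Lemma TA_bracketE p x y :
  B p x y =
  sgn R p *: Delta (x ** y) - sgn R p *: (Delta x ** y) - x ** Delta y.
Proof. by rewrite /TA_bracket -lock. Qed.

Lemma bracket_linearr p x : linear (B p x).
Proof. by move=> k y z; rewrite !TA_bracketE !TA_rules; lin_ring. Qed.

Definition bracket_rulesr p x := linear_rulesP (bracket_linearr p x).

Lemma bracketDl p x x' y : B p (x + x') y = B p x y + B p x' y.
Proof. by rewrite !TA_bracketE !TA_rules; lin_ring. Qed.

Lemma bracketZl p k x y : B p (k *: x) y = k *: B p x y.
Proof. by rewrite !TA_bracketE !TA_rules; lin_ring. Qed.

Lemma bracket0l p y : B p 0 y = 0.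
Proof. by rewrite !TA_bracketE !TA_rules; lin_ring. Qed.

Definition bracket_rules := (bracket_rulesr, (bracketDl, bracketZl, bracket0l)).

Lemma bracket1 y : B 0 tone y = 0.
Proof.
by rewrite TA_bracketE TA_Delta_one !TA_shuffle1 !TA_rules; lin_signs.
Qed.

Lemma bracketr1 p x : B p x tone = 0.
Proof.
by rewrite TA_bracketE TA_Delta_one !TA_shuffler1 !TA_rules; lin_signs.
Qed.

Lemma thom_bracket p q x y : thom p x -> thom q y -> thom (p + q - 1) (B p x y).
Proof.
move=> hx hy; rewrite TA_bracketE; apply: thomD; first apply: thomD.
- by apply: thomZ; apply: thom_Delta; exact: thom_shuffle.
- apply: thomN; apply: thomZ; rewrite addrAC.
  exact: thom_shuffle (thom_Delta hx) hy.
- by apply: thomN; rewrite -addrA; apply: thom_shuffle hx (thom_Delta hy).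
Qed.

(** A shuffle of x and b.y starts with a letter of x or with b. Merging a into
    it gives the shuffles of M_a x and b.y that do not start with b in the
    first case, and (ab).(x * y) in the second. *)
Lemma tmerge_shufflel q a r b p x y : hom q a -> hom r b -> thom p x ->
  tmerge a (x ** b ## y) =
  tmerge a x ** b ## y - sgn R ((r + 1) * (q + p)) *: b ## (tmerge a x ** y)
  + sgn R ((r + 1) * p) *: mu a b ## (x ** y).
Proof.
move=> ha hb; move: p x.
apply: thom_ind => [p|p k x x' _ _ IHx IHx'||s c p x hc hx _].
- by rewrite !TA_rules; lin_signs.
- by rewrite !TA_rules IHx IHx'; lin_ring.
- by rewrite tmerge_one !TA_shuffle1 tmerge_cons !TA_rules; lin_signs.
rewrite (TA_shuffle_cons _ hc hb hx) !TA_rules !tmerge_cons.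
rewrite (TA_shuffle_cons _ (dga_mu_deg dgaA ha hc) hb hx).
by lin_signs.
Qed.

(** The same for the right factor: a shuffle of a.x and y starts with a, or
    with a letter of y into which b is merged. *)
Lemma tmerge_shuffler q a r b p x y : hom q a -> hom r b -> thom p x ->
  tmerge b (a ## x ** y) =
  mu b a ## (x ** y) +
  sgn R (r * (q + 1 + p)) *: (a ## x ** tmerge b y - a ## (x ** tmerge b y)).
Proof.
move=> ha hb hx; elim/TA_ind: y => [|k y y' IHy IHy'||s c y hc _].
- by rewrite !TA_rules; lin_signs.
- by rewrite !TA_rules IHy IHy'; lin_ring.
- by rewrite tmerge_one !TA_shuffler1 tmerge_cons !TA_rules; lin_signs.
rewrite (TA_shuffle_cons _ ha hc hx) !TA_rules !tmerge_cons.
rewrite (TA_shuffle_cons _ ha (dga_mu_deg dgaA hb hc) hx).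
by lin_signs.
Qed.

(** In Delta (a.x * b.y) the letter in front is a or b; it is merged with the
    next letter or left alone. Mergers within a.x or within b.y cancel against
    Delta (a.x) * b.y and a.x * Delta (b.y). What is left is a bracket behind a
    or b, and the mergers of a with b in either order. *)
Lemma bracket_cons q a r b p k x y : hom q a -> hom r b -> thom p x ->
  k = q + 1 + p ->
  B k (a ## x) (b ## y) =
  a ## B p x (b ## y) + sgn R ((r + 1) * (q + p)) *: b ## B k (a ## x) y
  - sgn R (r * p) *: mu a b ## (x ** y)
  + sgn R (r * (q + p)) *: mu b a ## (x ** y).
Proof.
move=> ha hb hx ->; rewrite !TA_bracketE (TA_shuffle_cons _ ha hb hx) !TA_rules.
rewrite !(TA_Delta_cons _ ha) !(TA_Delta_cons _ hb) !TA_rules.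
rewrite (tmerge_shufflel _ ha hb hx) (tmerge_shuffler _ ha hb hx).
rewrite (TA_shuffle_cons _ ha hb (thom_Delta hx)).
rewrite (TA_shuffle_cons _ ha hb hx).
by lin_signs.
Qed.

(** By graded commutativity, exchanging the factors in each of the three terms
    of the bracket produces the three terms of the other bracket. *)
Lemma TA_bracketC p q x y : thom p x -> thom q y ->
  B p x y = - (sgn R ((p + 1) * (q + 1)) *: B q y x).
Proof.
move=> hx hy; rewrite !TA_bracketE (TA_shuffleC hx hy).
rewrite (TA_shuffleC (thom_Delta hx) hy) (TA_shuffleC hx (thom_Delta hy)).
rewrite !TA_rules.
by lin_signs.
Qed.

(** For a.x, b.y and c.z, the terms in which a, b or c stands alone in front
    agree by induction on the factor that has lost its first letter. The terms
    that start with a merger of c with a or b agree by associativity and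
    commutativity of the shuffle product; a merger of a with b occurs on
    neither side. *)
Lemma TA_bracket_leibniz p q r x y z : thom p x -> thom q y -> thom r z ->
  B (p + q) (x ** y) z =
  x ** B q y z + sgn R (q * (r + 1)) *: (B p x z ** y).
Proof.
move=> hx; move: p x hx q r y z.
apply: thom_ind => [p|p k x x' _ _ IHx IHx'||qa a p x ha hx IHx] q r y z hy.
- by move=> hz; rewrite !(TA_rules, bracket_rules); lin_ring.
- move=> hz; rewrite !(TA_rules, bracket_rules) (IHx _ _ _ _ hy hz).
  by rewrite (IHx' _ _ _ _ hy hz) ?TA_rules; lin_ring.
- by move=> hz; rewrite add0r !TA_shuffle1 bracket1 !TA_rules; lin_ring.
move: q y hy r z.
apply: thom_ind => [q|q k y y' _ _ IHy IHy'||qb b q y hb hy IHy] r z.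
- by move=> hz; rewrite !(TA_rules, bracket_rules); lin_ring.
- move=> hz; rewrite !(TA_rules, bracket_rules) (IHy _ _ hz) (IHy' _ _ hz).
  by rewrite ?TA_rules; lin_ring.
- move=> hz; rewrite addr0 !TA_shuffler1 bracket1 !TA_rules mul0r sgn0.
  by lin_ring.
move: r z; apply: thom_ind => [r|r k z z' _ _ IHz IHz'||qc c r z hc hz IHz].
- by rewrite !(TA_rules, bracket_rules); lin_ring.
- by rewrite !(TA_rules, bracket_rules) IHz IHz' ?TA_rules; lin_ring.
- by rewrite !bracketr1 !TA_rules; lin_ring.
have hax := thom_cons ha hx; have hby := thom_cons hb hy.
have hcz := thom_cons hc hz.
(* The hypothesis on z is about the sum of two brackets, one of which is solved
   for; the other then cancels in the comparison of coefficients. *)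
move: IHz; rewrite (TA_shuffle_cons _ ha hb hx) !bracket_rules.
move=> /(canRL (addrK _)) IHz.
rewrite (bracket_cons _ ha hc (thom_shuffle hx hby)); last by ring.
rewrite (bracket_cons _ hb hc (thom_shuffle hax hy)); last by ring.
rewrite IHz {IHz}.
rewrite (IHx _ _ _ _ hby hcz) (IHy _ _ hcz).
rewrite (bracket_cons _ ha hc hx erefl) (bracket_cons _ hb hc hy erefl).
rewrite !TA_rules.
rewrite (TA_shuffle_cons _ ha hb (thom_bracket hx hcz)).
rewrite (TA_shuffle_cons _ hc hb (thom_bracket hax hz)).
rewrite (TA_shuffle_cons _ (dga_mu_deg dgaA ha hc) hb (thom_shuffle hx hz)).
rewrite (TA_shuffle_cons _ (dga_mu_deg dgaA hc ha) hb (thom_shuffle hx hz)).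
rewrite (TA_shuffle_cons _ ha hb hx) (TA_shuffle_cons _ ha hc hx).
rewrite (TA_shuffle_cons _ ha (dga_mu_deg dgaA hb hc) hx).
rewrite (TA_shuffle_cons _ ha (dga_mu_deg dgaA hc hb) hx) ?TA_rules.
(* Both sides contain the product of x, b.y and z, in different orders. *)
rewrite -!TA_shuffleA (TA_shuffleC hz hby) ?TA_rules.
by lin_signs.
Qed.

End Recursion.

Lemma TA_dBV (R : comPzRingType) (A : dgAlgebra R) :
  is_dBV (@TA_hom R A) (@TA_d R A) (@TA_Delta R A) (@TA_shuffle R A).
Proof.
have bracketE p x y :
    bracket (@TA_Delta R A) (@TA_shuffle R A) p x y = TA_bracket p x y.
  by rewrite /TA_bracket -lock.
split.
- split; [exact: thom_grading (dga_grading (dga_axioms A)) | exact: TA_d_linear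
  | exact: thom_d | exact: TA_dd | exact: TA_shuffle_linearl
  | exact: TA_shuffle_linearr | exact: thom_shuffle | exact: TA_shuffleA
  | exact: TA_leibniz].
- exact: TA_shuffleC.
- exact: TA_Delta_linear.
- exact: thom_Delta.
- exact: TA_DeltaDelta.
- exact: TA_dDelta.
- by move=> p q x y; rewrite !bracketE; exact: TA_bracketC.
- by move=> p q r x y z; rewrite !bracketE; exact: TA_bracket_leibniz.
Qed.

(** * Functoriality *)

Lemma TA_map_linear (R : comPzRingType) (A B : lmodType R) (f : A -> B) :
  linear f -> linear (TA_map f).
Proof.
move=> fl; apply: tlift_linear => u k a b v.
by rewrite !map_cat /= fl tmon_multilinear.
Qed.

Lemma TA_map_cons (R : comPzRingType) (A B : lmodType R) (f : A -> B) a x :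
  linear f -> TA_map f (tcons a x) = tcons (f a) (TA_map f x).
Proof.
move=> fl; have TA_map_rules := linear_rulesP (TA_map_linear fl).
elim/tensor_span: x => [|k x y IHx IHy|w].
- by rewrite !(tcons_rules, TA_map_rules).
- by rewrite !(tcons_rules, TA_map_rules) IHx IHy.
- by rewrite tcons_mon !TA_map_mon // tcons_mon.
Qed.

Section Functoriality.
Variables (R : comPzRingType) (A B : dgAlgebra R) (f : A -> B).
Hypothesis fP : is_dga_morphism f.
Local Notation F := (TA_map f).

Let fl := dga_mor_linear fP.
Let F_rules := linear_rulesP (TA_map_linear fl).

Lemma TA_map_one : F tone = tone.
Proof. exact: TA_map_mon. Qed.

Lemma TA_map_merge a x : F (tmerge a x) = tmerge (f a) (F x).
Proof.
elim/TA_ind: x => [|k x y IHx IHy||q b x _ _].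
- by rewrite !(TA_rules, F_rules).
- by rewrite !(TA_rules, F_rules) IHx IHy.
- by rewrite TA_map_one !tmerge_one F_rules.
- by rewrite tmerge_cons !TA_map_cons // tmerge_cons (dga_mor_mu fP).
Qed.

Lemma TA_map_hom p x : TA_hom p x -> TA_hom p (F x).
Proof.
move: p x; apply: thom_ind => [p|p k x y _ _||q a p x ha hx IHx].
- by rewrite F_rules; exact: thom0.
- by rewrite !F_rules; exact: thom_linear.
- by rewrite TA_map_one; exact: thom_one.
- by rewrite TA_map_cons //; apply: thom_cons => //; exact: dga_mor_deg ha.
Qed.

Lemma TA_map_d x : F (TA_d x) = TA_d (F x).
Proof.
elim/TA_ind: x => [|k x y IHx IHy||q a x ha IHx].
- by rewrite !(TA_rules, F_rules).
- by rewrite !(TA_rules, F_rules) IHx IHy.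
- by rewrite TA_map_one !TA_d_one F_rules.
rewrite (TA_d_cons _ ha) TA_map_cons // (TA_d_cons _ (dga_mor_deg fP ha)).
by rewrite !F_rules !TA_map_cons // IHx (dga_mor_d fP).
Qed.

Lemma TA_map_Delta x : F (TA_Delta x) = TA_Delta (F x).
Proof.
elim/TA_ind: x => [|k x y IHx IHy||q a x ha IHx].
- by rewrite !(TA_rules, F_rules).
- by rewrite !(TA_rules, F_rules) IHx IHy.
- by rewrite TA_map_one !TA_Delta_one F_rules.
rewrite (TA_Delta_cons _ ha) TA_map_cons //.
rewrite (TA_Delta_cons _ (dga_mor_deg fP ha)).
by rewrite !F_rules TA_map_cons // TA_map_merge IHx.
Qed.

Lemma TA_map_shuffle x y : F (TA_shuffle x y) = TA_shuffle (F x) (F y).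
Proof.
elim/(thom_span (dga_grading (dga_axioms A))): x => [|k x x' IHx IHx'|p x hx].
- by rewrite !(TA_rules, F_rules).
- by rewrite !(TA_rules, F_rules) IHx IHx'.
move: p x hx y.
apply: thom_ind => [p|p k x x' _ _ IHx IHx'||q a p x ha hx IHx] y.
- by rewrite !(TA_rules, F_rules).
- by rewrite !(TA_rules, F_rules) IHx IHx'.
- by rewrite TA_map_one !TA_shuffle1.
elim/TA_ind: y => [|k y y' IHy IHy'||r b y hb IHy].
- by rewrite !(TA_rules, F_rules).
- by rewrite !(TA_rules, F_rules) IHy IHy'.
- by rewrite TA_map_one !TA_shuffler1.
have [hfa hfb] := (dga_mor_deg fP ha, dga_mor_deg fP hb).
rewrite (TA_shuffle_cons _ ha hb hx) !F_rules !TA_map_cons // IHx IHy.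
by rewrite !TA_map_cons // (TA_shuffle_cons _ hfa hfb (TA_map_hom hx)).
Qed.

End Functoriality.

Theorem theorem1 (R : comPzRingType) :
  (forall A : dgAlgebra R,
     is_dBV (@TA_hom R A) (@TA_d R A) (@TA_Delta R A) (@TA_shuffle R A)) /\
  (forall (A B : dgAlgebra R) (f : A -> B), is_dga_morphism f ->
     is_dBV_morphism (@TA_hom R A) (@TA_d R A) (@TA_Delta R A) (@TA_shuffle R A)
                     (@TA_hom R B) (@TA_d R B) (@TA_Delta R B) (@TA_shuffle R B)
                     (TA_map f)) /\
  (forall (A : dgAlgebra R) (x : tensor A), TA_map (@id A) x = x) /\
  (forall (A B C : dgAlgebra R) (f : A -> B) (g : B -> C),
     is_dga_morphism f -> is_dga_morphism g ->
     forall x : tensor A, TA_map (g \o f) x = TA_map g (TA_map f x)).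
Proof.
split; first exact: TA_dBV.
split=> [A B f fP|].
  split; [exact: TA_map_linear (dga_mor_linear fP) | exact: TA_map_hom
         | exact: TA_map_d | exact: TA_map_Delta | exact: TA_map_shuffle].
split=> [A x|A B C f g fP gP x].
  have idl : linear (@id A) by [].
  elim/tensor_span: x => [|k x y IHx IHy|w].
  - by rewrite (linear_rulesP (TA_map_linear idl)).
  - by rewrite TA_map_linear // IHx IHy.
  - by rewrite TA_map_mon // map_id.
have fl := dga_mor_linear fP; have gl := dga_mor_linear gP.
have gfl : linear (g \o f) by move=> k a b; rewrite /= fl gl.
elim/tensor_span: x => [|k x y IHx IHy|w].
- have [[_ _] [_ ->]] := linear_rulesP (TA_map_linear fl).
  have [[_ _] [_ ->]] := linear_rulesP (TA_map_linear gl).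
  by have [[_ _] [_ ->]] := linear_rulesP (TA_map_linear gfl).
- by rewrite TA_map_linear // IHx IHy !TA_map_linear.
- by rewrite !TA_map_mon // map_comp.
Qed.
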